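(* Every sLICM function $g:\,]0,\infty[\,\to\mathbb{R}$ is a Sonine function, and the associated Sonine function $f$ is sLICM. If $g$ is LICM and regular at $0$, then there are a unique positive number $a$ and a unique LICM function $\varphi$ such that $$a\, g + g\ast\varphi = 1 .$$
   Context: A function $f$ on $]0,\infty[$ is completely monotone (CM) if it is infinitely differentiable and $(-1)^n f^{(n)}(t)\ge 0$ for all $t>0$ and $n=0,1,2,\ldots$. A LICM function is a CM function that is locally integrable (equivalently, integrable over $[0,1]$). A LICM function is called singular at $0$, or an sLICM function, if it is unbounded near $0$; it is regular at $0$ if it is not singular at $0$. The convolution is $(f\ast g)(t)=\int_0^t f(s)\,g(t-s)\,ds$. $L^1_{\mathrm{loc}}([0,\infty[)$ denotes the locally integrable functions on $[0,\infty[$. A function $g\in L^1_{\mathrm{loc}}([0,\infty[)$ is a Sonine function if there is $f\in L^1_{\mathrm{loc}}([0,\infty[)$ satisfying the Sonine equation $(g\ast f)(t)=1$ $(t\ge 0)$; such an $f$ is unique in $L^1_{\mathrm{loc}}([0,\infty[)$ and is called the associated Sonine function of $g$.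
   Formalization: In the second part g is additionally assumed not to be identically zero on ]0,∞[; for g = 0, which is LICM and regular at 0, the equation a g + g∗φ = 1 has no solution. *)

(* Defs.v *)
From HB Require Import structures.
From mathcomp Require Import all_boot all_order all_algebra.
From mathcomp Require Import all_classical all_reals all_analysis.
Import Order.TTheory GRing.Theory Num.Theory.
Import numFieldNormedType.Exports.
Set Implicit Arguments.
Unset Strict Implicit.
Unset Printing Implicit Defensive.
Local Open Scope classical_set_scope.
Local Open Scope ring_scope.

(* A function on ]0, +oo[ is a total function R -> R of which only the values
   at positive arguments are ever used; iterated derivatives at t > 0 are
   local, so they do not see the values at nonpositive arguments either. *)
Section Sonine.
Context {R : realType}.
Implicit Types f g : R -> R.

Local Notation mu := (@lebesgue_measure R).

Definition completely_monotone f : Prop :=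
  forall (n : nat) (t : R), 0 < t ->
    derivable (derive1n n f) t 1 /\ 0 <= (-1) ^+ n * derive1n n f t.

(* Local integrability on [0, +oo[, up to and including the endpoint 0.  The
   library's [locally_integrable] requires an open domain, hence would not
   constrain f near 0. *)
Definition L1loc f : Prop :=
  forall b : R, 0 < b -> mu.-integrable `]0, b] (EFin \o f).

Definition licm f : Prop := completely_monotone f /\ L1loc f.

Definition singular_at0 f : Prop := ~ bounded_near f (0 : R)^'+.

Definition regular_at0 f : Prop := ~ singular_at0 f.

Definition slicm f : Prop := licm f /\ singular_at0 f.

(* Extended-real valued: the value is finite only if the integral of a
   measurable integrand converges absolutely.  The open interval avoids the
   meaningless values of f and g at 0. *)
Definition conv f g (t : R) : \bar R :=
  (\int[mu]_(s in `]0%R, t[) (f s * g (t - s))%:E)%E.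

(* At t = 0 the integral is 0 for trivial reasons, so the equation is read on
   ]0, +oo[. *)
Definition sonine_eq g f : Prop := forall t : R, 0 < t -> conv g f t = 1%E.

Definition sonine_associated g f : Prop := L1loc f /\ sonine_eq g f.

Definition sonine g : Prop := L1loc g /\ exists f, sonine_associated g f.

Definition regular_sonine_eq (a : R) g phi : Prop :=
  forall t : R, 0 < t -> ((a * g t)%:E + conv g phi t = 1)%E.

End Sonine.

(* Main.v *)
Require Import Defs.
From HB Require Import structures.
From mathcomp Require Import all_boot all_order all_algebra.
From mathcomp Require Import zify ring lra.
From mathcomp Require Import all_classical all_reals all_analysis.
From mathcomp Require Import measurable_realfun.
Import Order.TTheory GRing.Theory Num.Theory.
Import numFieldNormedType.Exports.
Local Open Scope classical_set_scope.
Local Open Scope ring_scope.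

(** Existence is proved by discretisation, without Bernstein's theorem.  For a
    step [h = 1/N] the sequence [a_k = g((k+1)h)] is completely monotone, so the
    functional [L(X^k) = a_k] is nonnegative on the polynomials that are
    nonnegative on the unit interval.  Let [S p = X p - L(X p)/a_0].  For the
    form [L(X p q)] the operator [S] is self-adjoint with [0 <= S <= 1], and its
    moments [b_n = L(X S^n 1)/a_0] satisfy the renewal equation
    [a_(n+1) = sum_(k <= n) b_k a_(n-k)].  Hence [b] is completely monotone, and
    so is the sequence [c] given by [c_0 = 1/a_0], [c_n - c_(n+1) = b_n/a_0],
    which solves [sum_(k <= n) a_(n-k) c_k = 1].

    As [N] grows, the step functions [N c_(floor(tN))] and their scaled
    differences converge along an ultrafilter to a function [f] and to
    [(-1)^k f^(k)]; so [f] is completely monotone, and by monotonicity some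
    subsequence converges to [f] pointwise.  Dominated convergence turns the
    discrete equation into [b g + g * f = 1] with [b = inf 1/g]: the term
    [b g(t)] is the contribution of [c_0 = 1/g(h)], and [b = 0] exactly when [g]
    is singular.

    For uniqueness, compute the double integral of [f_1(u) f_2(v) g(t-u-v)] in
    both orders: this shows that [f_1] and [f_2] have equal primitives. *)

Set Implicit Arguments.
Unset Strict Implicit.
Unset Printing Implicit Defensive.

(** * Completely monotone sequences *)

(** With the forward difference D this is $(-1)^k D^k a$, the discrete counterpart of $(-1)^k
    f^{(k)}$. *)
Definition fdiff (R : zmodType) (k : nat) (a : nat -> R) : nat -> R :=
  iter k (fun b n => b n - b n.+1) a.

Definition cm_seq (R : numDomainType) (a : nat -> R) : Prop :=
  forall k n, 0 <= fdiff k a n.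

(** The linear functional L with $L(X^i) = a_i$. For a Hausdorff moment sequence it is integration
    against the representing measure, which is never constructed here. *)
Definition moment (R : nzRingType) (a : nat -> R) (p : {poly R}) : R :=
  \sum_(i < size p) p`_i * a i.

Section Moment.
Context {R : comNzRingType}.
Variable a : nat -> R.

Lemma moment_widen n (p : {poly R}) :
  (size p <= n)%N -> moment a p = \sum_(i < n) p`_i * a i.
Proof.
move=> le_pn; rewrite /moment -!(big_mkord xpredT (fun i => p`_i * a i)).
rewrite [RHS](big_cat_nat (n := size p)) //= [X in _ + X]big_nat_cond.
rewrite [X in _ + X]big1 ?addr0 // => i /andP[/andP[le_pi _] _].
by rewrite nth_default ?mul0r.
Qed.

Lemma moment_is_linear : linear_for *%R (moment a).
Proof.
move=> c p q; set n := maxn (size p) (size q).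
have le_n : (size (c *: p + q)%R <= n)%N.
  rewrite (leq_trans (size_polyD _ _)) // geq_max leq_maxr andbT.
  by rewrite (leq_trans (size_scale_leq _ _)) // leq_maxl.
rewrite (moment_widen le_n) (@moment_widen n p) ?leq_maxl //.
rewrite (@moment_widen n q) ?leq_maxr // mulr_sumr -big_split /=.
by apply: eq_bigr => i _; rewrite coefD coefZ mulrDl mulrA.
Qed.

HB.instance Definition _ :=
  GRing.isLinear.Build R {poly R} R *%R (moment a) moment_is_linear.

Lemma momentZ c p : moment a (c *: p) = c * moment a p.
Proof. by rewrite -[c *: p]addr0 moment_is_linear raddf0 addr0. Qed.

Lemma momentXn n : moment a 'X^n = a n.
Proof.
rewrite /moment size_polyXn big_ord_recr /= coefXn eqxx mul1r big1 ?add0r //.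
by move=> i _; rewrite coefXn ltn_eqF ?mul0r.
Qed.

Lemma moment1 : moment a 1 = a 0.
Proof. by rewrite -(expr0 'X) momentXn. Qed.

(** Complete monotonicity of [a] thus says that L is nonnegative on the products $X^n (1-X)^k$. *)
Lemma moment_basis k n : moment a ('X^n * (1 - 'X) ^+ k) = fdiff k a n.
Proof.
elim: k n => [|k IHk] n; first by rewrite expr0 mulr1 momentXn.
rewrite /fdiff iterS -/(fdiff k a) -!IHk -raddfB /=; congr moment.
by rewrite !exprS; ring.
Qed.

(** Apply L to the binomial expansion of $X^i = X^i ((1-X) + X)^{M-i}$. *)
Lemma moment_bernstein (i M : nat) : (i <= M)%N ->
  a i = \sum_(j < (M - i).+1) fdiff (M - i - j) a (i + j) *+ 'C(M - i, j).
Proof.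
move=> le_iM; rewrite -(momentXn i).
have -> : 'X^i = 'X^i * ((1 - 'X) + 'X) ^+ (M - i) :> {poly R}.
  by rewrite subrK expr1n mulr1.
rewrite exprDn mulr_sumr raddf_sum /=; apply: eq_bigr => j _.
rewrite mulrnAr raddfMn /= -moment_basis; congr (moment a _ *+ _).
by rewrite exprD; ring.
Qed.

End Moment.

(** * Positivity of the moment functional on the unit interval *)

Section HausdorffPositivity.
Context {R : archiRealFieldType}.

(** The coefficient $\binom{M-i}{k-i} / \binom{M}{k}$ of $X^i$ along the Bernstein polynomial of
    index k and degree M; it is close to $(k/M)^i$. *)
Let rho (M k i : nat) : R := (k ^_ i)%:R / (M ^_ i)%:R.

(** The value of L at the Bernstein polynomial $\binom{M}{k} X^k (1-X)^{M-k}$. *)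
Let wt (a : nat -> R) (M k : nat) : R := fdiff (M - k) a k *+ 'C(M, k).

Let moment_weight (a : nat -> R) (i M : nat) : (i <= M)%N ->
  a i = \sum_(k < M.+1) wt a M k * rho M k i.
Proof.
move=> le_iM; rewrite (moment_bernstein a le_iM).
rewrite -(big_mkord xpredT (fun k => wt a M k * rho M k i)).
rewrite -(big_mkord xpredT (fun j => fdiff (M - i - j) a (i + j) *+ 'C(M - i, j))).
rewrite [RHS](big_cat_nat (n := i)) //=; last exact: leqW.
rewrite [X in _ = X + _]big_nat_cond [X in _ = X + _]big1; last first.
  move=> k /andP[/andP[_ ltki] _].
  by rewrite /= /rho ffact_small // mul0r mulr0.
rewrite add0r; rewrite -[X in _ = \sum_(X <= _ < _) _](add0n i) big_addn -subSn //.
rewrite !big_nat; apply: eq_bigr => j /andP[_ ltj].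
rewrite /wt /rho (addnC j) -subnDA.
rewrite -[LHS]mulr_natr -[X in _ = X * _]mulr_natr -mulrA.
congr (_ * _).
have Mi0 : (M ^_ i)%:R != 0 :> R by rewrite pnatr_eq0 -lt0n ffact_gt0.
apply: (mulIf Mi0); rewrite -mulrA divfK // -!natrM; congr (_%:R).
have le_j : (j <= M - i)%N by rewrite -ltnS -subSn.
have le_ij : (i + j <= M)%N by rewrite -leq_subRL.
(* Multiplied by $j! (M-i-j)!$, both sides become $M!$. *)
apply/eqP; rewrite -(eqn_pmul2r (fact_gt0 (M - (i + j)))).
rewrite -(eqn_pmul2r (fact_gt0 j)); apply/eqP.
have := bin_fact le_ij.
have := bin_fact le_j; rewrite -subnDA => E3 E2.
have E4 : ((i + j) ^_ i * j`! = (i + j)`!)%N.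
  by rewrite -(ffact_fact (leq_addr j i)) addKn.
have E5 := ffact_fact le_iM.
transitivity (M ^_ i * ('C(M - i, j) * (j`! * (M - (i + j))`!)))%N; first by ring.
rewrite E3 E5 -E2 -E4; ring.
Qed.


(** [rho] is a product of i factors (k-l)/(M-l) in the unit interval. Each is within 2K/M of k/M,
    because $2K \le M$ keeps M-l above M/2, and the errors add up. *)
Let rho_close (K M k i : nat) : (0 < M)%N -> (2 * K <= M)%N -> (k <= M)%N ->
  (i <= K)%N ->
  [/\ 0 <= rho M k i, rho M k i <= 1 &
      `|rho M k i - (k%:R / M%:R) ^+ i| <= (i * (2 * K))%:R / M%:R].
Proof.
move=> M0 leKM lekM; elim: i => [|i IHi] ltiK.
  by rewrite /rho !ffactn0 expr0 divr1 subrr normr0 mul0n mul0r; split.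
have [rho0 rho1 rhoE] := IHi (ltnW ltiK).
have M0R : 0 < M%:R :> R by rewrite ltr0n.
have iM : (i < M)%N by lia.
have MiR : 0 < M%:R - i%:R :> R by rewrite subr_gt0 ltr_nat.
have rhoS : rho M k i.+1 = rho M k i * ((k - i)%:R / (M - i)%:R).
  rewrite /rho !ffactnSr !natrM invfM; ring.
set y : R := (k - i)%:R / (M - i)%:R in rhoS.
set x : R := k%:R / M%:R in rhoE *.
have y0 : 0 <= y by rewrite divr_ge0.
have y1 : y <= 1.
  by rewrite ler_pdivrMr ?ltr0n ?subn_gt0 // mul1r ler_nat leq_sub2r.
have x0 : 0 <= x by rewrite divr_ge0.
have x1 : x <= 1 by rewrite ler_pdivrMr // mul1r ler_nat.
have KM : (2 * K)%:R / M%:R >= i%:R / (M%:R - i%:R) :> R.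
  rewrite ler_pdivrMr // mulrAC ler_pdivlMr // -natrB ?(ltnW iM) // -!natrM.
  rewrite ler_nat; nia.
have yx : `|y - x| <= (2 * K)%:R / M%:R.
  apply: le_trans KM; case: (leqP i k) => [leik|ltki].
    rewrite /y /x !natrB // ?(ltnW iM) //.
    have -> : (k%:R - i%:R) / (M%:R - i%:R) - k%:R / M%:R =
        - (i%:R / (M%:R - i%:R) * (1 - k%:R / M%:R)) :> R.
      by field; rewrite !gt_eqF.
    rewrite normrN ger0_norm ?mulr_ge0 ?subr_ge0 ?divr_ge0 ?invr_ge0 ?(ltW MiR) //.
    by rewrite ler_piMr ?mulr_ge0 ?invr_ge0 ?(ltW MiR) // gerBl.
  have -> : y = 0.
    by move/ltnW: ltki; rewrite /y -subn_eq0 => /eqP ->; rewrite mul0r.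
  rewrite sub0r normrN ger0_norm // ler_pdivrMr // mulrAC ler_pdivlMr //.
  rewrite -natrB ?(ltnW iM) // -!natrM ler_nat; nia.
split; first by rewrite rhoS mulr_ge0.
  by rewrite rhoS mulr_ile1.
rewrite rhoS exprSr.
have -> : rho M k i * y - x ^+ i * x =
    (rho M k i - x ^+ i) * y + x ^+ i * (y - x) by ring.
rewrite (le_trans (ler_normD _ _)) // [`|_ * y|]normrM [`|_ * (y - x)|]normrM.
rewrite (ger0_norm y0) (ger0_norm (exprn_ge0 i x0)).
rewrite mulSn natrD mulrDl addrC lerD //.
  by rewrite (le_trans _ yx) // ler_piMl // exprn_ile1.
by rewrite (le_trans _ rhoE) // ler_piMr.
Qed.

(* Up to O(1/M), [moment a p] is the sum of the values of [p] at the grid points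
   [k/M] with the nonnegative weights [wt a M k]. *)
Lemma moment_ge0 (a : nat -> R) (p : {poly R}) : cm_seq a ->
  (forall x, 0 <= x -> x <= 1 -> 0 <= p.[x]) -> 0 <= moment a p.
Proof.
move=> cma p0; set K := size p.
(* [C / M] bounds the whole error: [rho_close] for each coefficient of [p], times the total weight
   $a_0$. *)
pose C : R := (\sum_(i < K) `|p`_i|) * (K * (2 * K))%:R * a 0%N.
have sum_wt M : \sum_(k < M.+1) wt a M k = a 0%N.
  rewrite [RHS](@moment_weight a 0 M) //; apply: eq_bigr => k _.
  by rewrite /rho !ffactn0 divr1 mulr1.
have lowb M : (0 < M)%N -> (2 * K <= M)%N -> - (C / M%:R) <= moment a p.
  move=> M0 leKM; have M0R : 0 < M%:R :> R by rewrite ltr0n.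
  pose D : R := (\sum_(i < K) `|p`_i|) * ((K * (2 * K))%:R / M%:R).
  have -> : - (C / M%:R) = \sum_(k < M.+1) wt a M k * (- D).
    by rewrite -mulr_suml sum_wt /C /D; ring.
  have -> : moment a p =
      \sum_(k < M.+1) wt a M k * \sum_(i < K) p`_i * rho M k i.
    under [RHS]eq_bigr do rewrite mulr_sumr.
    rewrite exchange_big /=; apply: eq_bigr => i _.
    rewrite (@moment_weight a i M); last by have := ltn_ord i; rewrite -/K; lia.
    by rewrite mulr_sumr; apply: eq_bigr => k _; ring.
  apply: ler_sum => k _; apply: ler_wpM2l.
    by rewrite mulrn_wge0 //; apply: cma.
  set x : R := k%:R / M%:R.
  have lekM : (k <= M)%N by rewrite -ltnS.
  have px : 0 <= p.[x].
    by apply: p0; rewrite ?divr_ge0 // ler_pdivrMr // mul1r ler_nat.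
  apply: le_trans (_ : - D + p.[x] <= _); first by rewrite lerDl.
  rewrite addrC lerBlDl -lerBlDr.
  rewrite horner_coef -sumrB (le_trans (ler_norm _)) //.
  rewrite (le_trans (ler_norm_sum _ _ _)) // /D mulr_suml ler_sum // => i _.
  rewrite -mulrBr normrM ler_wpM2l // distrC.
  have [_ _ h] := rho_close M0 leKM lekM (ltnW (ltn_ord i)).
  rewrite (le_trans h) // ler_wpM2r ?invr_ge0 // ler_nat leq_mul2r.
  by rewrite (ltnW (ltn_ord i)) orbT.
rewrite leNgt; apply/negP => Lneg.
pose e := - moment a p; have e0 : 0 < e by rewrite oppr_gt0.
pose M := (Num.bound (`|C| / e) + 2 * K)%N.
have Mb : `|C| / e < M%:R.
  rewrite (lt_le_trans (archi_boundP _)) ?divr_ge0 ?(ltW e0) //.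
  by rewrite ler_nat leq_addr.
have M0 : (0 < M)%N by rewrite -(ltr_nat R) (le_lt_trans _ Mb) // divr_ge0 // ltW.
have := lowb M M0 (leq_addl _ _); apply/negP; rewrite -ltNge.
rewrite ltrNr -/e ltr_pdivrMr ?ltr0n // mulrC.
by rewrite (le_lt_trans (ler_norm _)) // -ltr_pdivrMr.
Qed.

End HausdorffPositivity.

(** * Multiplication by X, projected to the kernel of the functional *)

Section HausdorffForm.
Context {R : archiRealFieldType}.
Variable a : nat -> R.
Hypothesis cma : cm_seq a.
Local Notation L := (moment a).

(** The test polynomials $p^2$, $X p^2$ and $X(1-X) p^2$ yield, in this order, $S \ge 0$, positivity
    of the form, and $S \le 1$. *)
Lemma moment_sqr_ge0 p : 0 <= L (p * p).
Proof. by apply: moment_ge0 => // x _ _; rewrite hornerM -expr2 sqr_ge0. Qed.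

Lemma moment_Xsqr_ge0 p : 0 <= L ('X * (p * p)).
Proof.
apply: moment_ge0 => // x x0 _.
by rewrite !hornerM hornerX -expr2 mulr_ge0 ?sqr_ge0.
Qed.

Lemma moment_X1Xsqr_ge0 p : 0 <= L ('X * (1 - 'X) * (p * p)).
Proof.
apply: moment_ge0 => // x x0 x1.
have -> : ('X * (1 - 'X) * (p * p)).[x] = x * (1 - x) * p.[x] ^+ 2.
  by rewrite !hornerE; ring.
apply: mulr_ge0; last exact: sqr_ge0.
by apply: mulr_ge0; rewrite ?subr_ge0.
Qed.

Lemma cm_seq_ge0 n : 0 <= a n.
Proof. exact: (cma 0 n). Qed.

Lemma cm_seq_noninc n m : (n <= m)%N -> a m <= a n.
Proof.
elim: m => [|m IHm]; first by rewrite leqn0 => /eqP ->.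
rewrite leq_eqVlt => /predU1P[-> //|/IHm]; apply: le_trans.
by rewrite -subr_ge0; apply: (cma 1 m).
Qed.

Lemma cm_seq_logconvex n : a n.+1 ^+ 2 <= a n * a n.+2.
Proof.
have an : 0 <= a n by exact: cm_seq_ge0.
have an2 : 0 <= a n.+2 by exact: cm_seq_ge0.
have quad t : 0 <= a n.+2 - t * a n.+1 *+ 2 + t ^+ 2 * a n.
  have : 0 <= L ('X^n * (('X - t%:P) * ('X - t%:P))).
    apply: moment_ge0 => // x x0 _.
    by rewrite !hornerM hornerXn -expr2 mulr_ge0 ?sqr_ge0 ?exprn_ge0.
  have -> : 'X^n * (('X - t%:P) * ('X - t%:P)) =
      'X^(n.+2) - (t *+ 2) *: 'X^(n.+1) + (t ^+ 2) *: 'X^n :> {poly R}.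
    by rewrite -!mul_polyC rmorphMn rmorphXn /= !exprS; ring.
  rewrite raddfD raddfB /= !momentZ !momentXn. by rewrite mulrnAl.
(* The first value of t minimises the quadratic if $a_n \ne 0$. If $a_n = 0$, the second would make
   it negative unless $a_{n+1} = 0$. *)
have := quad (a n.+1 / a n); have := quad ((a n.+2 + 1) / a n.+1).
case: (eqVneq (a n) 0) => [->|an0] q1 q2.
  case: (eqVneq (a n.+1) 0) => [->|an1]; first by rewrite mul0r expr0n.
  by move: q1; rewrite divfK // mulr0 addr0; lra.
have an0' : 0 < a n by rewrite lt_def an0.
rewrite -subr_ge0.
have -> : a n * a n.+2 - a n.+1 ^+ 2 = a n *
    (a n.+2 - a n.+1 / a n * a n.+1 *+ 2 + (a n.+1 / a n) ^+ 2 * a n).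
  by field.
by rewrite mulr_ge0.
Qed.

(** Log-convexity propagates positivity. Two initial terms are required: 1, 0, 0, ... is completely
    monotone. *)
Lemma cm_seq_gt0 : 0 < a 0 -> 0 < a 1 -> forall n, 0 < a n.
Proof.
move=> a0 a1 n; suff [] : 0 < a n /\ 0 < a n.+1 by [].
elim: n => [//|n [an an1]]; split=> //.
rewrite -(pmulr_rgt0 _ an); apply: lt_le_trans (cm_seq_logconvex n).
by rewrite exprn_gt0.
Qed.

Hypothesis a_gt0 : forall n, 0 < a n.

Let a0N0 : a 0 != 0. Proof. by rewrite gt_eqF. Qed.

Let B (p q : {poly R}) : R := L ('X * (p * q)).
(** The projection is orthogonal to the constants for the form L(pq); the form [B] carries the extra
    factor X that makes [S] self-adjoint. *)
Let S (p : {poly R}) : {poly R} := 'X * p - (L ('X * p) / a 0)%:P.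
Let T (p : {poly R}) : {poly R} := p - S p.

Let B_sub p q r : B p (q - r) = B p q - B p r.
Proof. by rewrite /B !mulrBr raddfB. Qed.

Let B_add p q r : B p (q + r) = B p q + B p r.
Proof. by rewrite /B !mulrDr raddfD. Qed.

Let S_sub p q : S (p - q) = S p - S q.
Proof. by rewrite /S mulrBr raddfB mulrBl rmorphB /=; ring. Qed.

Let TS p : T (S p) = S (T p).
Proof. exact: esym (S_sub _ _). Qed.

Let B_sym p q : B p q = B q p.
Proof. by rewrite /B [p * q]mulrC. Qed.

Let B_SE p q :
  B (S p) q = L ('X * 'X * (p * q)) - L ('X * p) * L ('X * q) / a 0.
Proof.
have -> : B (S p) q =
    L ('X * 'X * (p * q) - (L ('X * p) / a 0) *: ('X * q)).
  by congr L; rewrite -mul_polyC /S; ring.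
by rewrite raddfB /= momentZ; ring.
Qed.

Let B_S p q : B (S p) q = B p (S q).
Proof. by rewrite [RHS]B_sym !B_SE [q * p]mulrC; ring. Qed.

Let B_T p q : B (T p) q = B p (T q).
Proof.
rewrite [LHS]B_sym (B_sub q p (S p)) (B_sub p q (S q)).
by rewrite -(B_S p q) !(B_sym q).
Qed.

Let L_S p : L (S p) = 0.
Proof.
rewrite /S raddfB /= -[X in _ - L X]mulr1 mul_polyC momentZ moment1.
by rewrite divfK // subrr.
Qed.

(** In fact $B(p, Sp) = L((Sp)^2)$, because L vanishes on the range of [S]. *)
Let B_S_ge0 p : 0 <= B p (S p).
Proof.
rewrite -B_S B_SE.
have := moment_sqr_ge0 (S p).
have -> : S p * S p =
    'X * 'X * (p * p) - (L ('X * p) / a 0) *: ('X * p) - (L ('X * p) / a 0) *: S p.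
  by rewrite -!mul_polyC /S; ring.
by rewrite raddfB raddfB /= !momentZ L_S mulr0 subr0 [_ / _ * _]mulrAC.
Qed.

(** Here $B(p, Tp) = L(X(1-X)p^2) + L(Xp)^2/a_0$. *)
Let B_T_ge0 p : 0 <= B p (T p).
Proof.
rewrite /T B_sub -B_S B_SE opprB addrCA addr_ge0 //.
  by rewrite divr_ge0 ?cm_seq_ge0 // -expr2 sqr_ge0.
rewrite /B -raddfB /=; have := moment_X1Xsqr_ge0 p.
by congr (0 <= L _); ring.
Qed.

Let iterS_S k p : iter k S (S p) = S (iter k S p).
Proof. by rewrite -iterS iterSr. Qed.

Let iterT_S k p : iter k T (S p) = S (iter k T p).
Proof. by elim: k => [//|k IHk]; rewrite !iterS IHk TS. Qed.

Let iterS_T k p : iter k S (T p) = T (iter k S p).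
Proof. by elim: k => [//|k IHk]; rewrite !iterS IHk -TS. Qed.

(* Without a spectral theorem: even powers move to the other side by
   self-adjointness, and S T = T S T + S T S since S + T = 1. *)
Let B_iter_ge0 n k p : 0 <= B p (iter n S (iter k T p)).
Proof.
have [N] := ubnP (n + k); elim: N n k p => [//|N IHN] n k p leN.
case: n leN => [|[|n]] leN.
- case: k leN => [|[|k]] leN /=; first exact: moment_Xsqr_ge0.
    exact: B_T_ge0.
  rewrite -B_T -iterS iterSr; apply: (IHN 0 k (T p)); lia.
- case: k leN => [|[|k]] leN /=; first exact: B_S_ge0.
    have -> : B p (S (T p)) = B (T p) (S (T p)) + B (S p) (T (S p)).
      by rewrite B_T B_S -B_add (TS p) [in X in _ = B _ (X + _)]/T subrK.
    by rewrite addr_ge0.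
  by rewrite -TS -B_T -iterS iterSr; apply: (IHN 1 k (T p)); lia.
- rewrite iterS -B_S iterS -iterS_S -iterT_S; apply: (IHN n k (S p)); lia.
Qed.

Let b n := B 1 (iter n S 1) / a 0.

Let fdiff_b k n : fdiff k b n = B 1 (iter n S (iter k T 1)) / a 0.
Proof.
elim: k n => [//|k IHk] n; rewrite /fdiff iterS -/(fdiff k b) !IHk -mulrBl.
by congr (_ / _); rewrite -B_sub iterS iterS_T -iterS.
Qed.

Let cm_b : cm_seq b.
Proof. by move=> k n; rewrite fdiff_b divr_ge0 ?B_iter_ge0 ?cm_seq_ge0. Qed.

(** Iterate $Xq = Sq + L(Xq)/a_0$ from q = 1: the constant $b_k$ split off at stage k is multiplied
    by X at all later stages. *)
Let Xn_expand n : 'X^n = iter n S 1 + \sum_(k < n) b k *: 'X^(n.-1 - k).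
Proof.
elim: n => [|n IHn]; first by rewrite expr0 big_ord0 addr0.
rewrite exprS {1}IHn mulrDr big_ord_recr /= subnn expr0.
have -> : 'X * iter n S 1 = S (iter n S 1) + b n *: 1 :> {poly R}.
  by rewrite -mul_polyC /S /b /B mul1r; ring.
rewrite -addrA [_ *: 1 + _]addrC mulr_sumr; congr (_ + (_ + _)).
apply: eq_bigr => k _; rewrite -scalerAr -exprS; congr (_ *: 'X^_).
by have := ltn_ord k; lia.
Qed.

Let renewal n : a n.+1 = \sum_(k < n.+1) b k * a (n - k).
Proof.
rewrite -(momentXn a n.+1) Xn_expand iterS raddfD /= L_S add0r raddf_sum /=.
by apply: eq_bigr => k _; rewrite momentZ momentXn.
Qed.

(** In generating functions, renewal reads $A = a_0 + zAB$, and $C = (1 - zB)/(a_0(1-z))$, whence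
    $AC = 1/(1-z)$. *)
Lemma cm_seq_reciprocal :
  exists2 c, cm_seq c & forall n, \sum_(k < n.+1) a (n - k) * c k = 1.
Proof.
pose c n := (1 - \sum_(k < n) b k) / a 0.
have c_diff n : c n - c n.+1 = b n / a 0.
  by rewrite /c big_ord_recr /= -mulrBl; congr (_ / _); ring.
have b_ge0 n : 0 <= b n by exact: (cm_b 0).
exists c; last first.
  elim=> [|n <-]; first by rewrite big_ord_recr big_ord0 /= /c big_ord0; field.
  rewrite big_ord_recl /= subn0 renewal mulr_suml -big_split /=.
  apply: eq_bigr => k _; rewrite /bump /= add1n subSS.
  have -> : c k.+1 = c k - b k / a 0 by rewrite -c_diff; ring.
  by rewrite {1}/c big_ord0; ring.
(* This is $c \ge 0$: by renewal and monotonicity, $a_n \sum_{k \le n} b_k \le a_{n+1} \le a_n$. *)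
have sum_b n : \sum_(k < n) b k <= 1.
  case: n => [|n]; first by rewrite big_ord0.
  rewrite -(ler_pM2r (a_gt0 n)) mul1r.
  apply: le_trans (cm_seq_noninc (leqnSn n)); rewrite renewal mulr_suml.
  apply: ler_sum => k _; apply: ler_wpM2l => //.
  exact/cm_seq_noninc/leq_subr.
move=> [|k] n; first by rewrite /fdiff /= divr_ge0 ?subr_ge0 ?cm_seq_ge0.
have -> : fdiff k.+1 c n = fdiff k b n / a 0.
  elim: k n => [|k IHk] n; first exact: c_diff.
  by rewrite /fdiff iterS -/(fdiff k.+1 c) !IHk -mulrBl /fdiff iterS.
by rewrite divr_ge0 ?cm_seq_ge0.
Qed.

End HausdorffForm.

(** * Completely monotone functions as limits of sequences *)

Lemma eq_fdiff (R : zmodType) k (a b : nat -> R) :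
  a =1 b -> fdiff k a =1 fdiff k b.
Proof.
by move=> ab; elim: k => [//|k IHk] n; rewrite /fdiff !iterS -!/(fdiff _ _) !IHk.
Qed.

Section CompletelyMonotoneFamily.
Context {R : realType}.
Implicit Types (f g : R -> R) (G : nat -> R -> R).

(* [G n] plays the role of [(-1)^n f^(n)]. *)
Definition cm_family G : Prop :=
  forall n t, 0 < t -> 0 <= G n t /\ is_derive t 1 (G n) (- G n.+1 t).

Lemma cm_family_of_cm f : completely_monotone f ->
  cm_family (fun n t => (-1) ^+ n * derive1n n f t).
Proof.
move=> cmf n t t0; have [df f0] := cmf n t t0; split => //.
have dfn : is_derive t 1 (derive1n n f) (derive1n n.+1 f t).
  by apply: DeriveDef => //; rewrite derive1nS derive1E.
by rewrite exprS mulN1r mulNr opprK; exact: (is_deriveZ ((-1) ^+ n) dfn).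
Qed.

Lemma cm_of_cm_family G : cm_family G -> completely_monotone (G 0%N).
Proof.
move=> cmG.
have E n t : 0 < t -> derive1n n (G 0%N) t = (-1) ^+ n * G n t.
  elim: n t => [|n IHn] t t0; first by rewrite expr0 mul1r.
  have [_ dG] := cmG n t t0.
  rewrite derive1nS derive1E (@near_eq_derive _ _ _ _ ((-1) ^+ n \*o G n)).
    rewrite deriveMl; last exact: ex_derive.
    by rewrite derive_val exprS mulN1r mulrN mulNr.
  by near=> s; apply: IHn; near: s; exact: lt_nbhsr.
move=> n t t0; have [G0 dG] := cmG n t t0; rewrite E // mulrA -expr2 sqrr_sign.
rewrite mul1r; split => //.
apply: (@near_eq_derivable _ _ _ ((-1) ^+ n \*o G n)).
  by near=> s; apply/esym/E; near: s; exact: lt_nbhsr.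
by apply: derivableM; [exact: derivable_cst|exact: ex_derive].
Unshelve. all: by end_near. Qed.

Lemma cm_family_continuous G n t : cm_family G -> 0 < t ->
  {for t, continuous (G n)}.
Proof.
move=> cmG t0; have [_ dG] := cmG n t t0.
by apply/differentiable_continuous/derivable1_diffP; exact: ex_derive.
Qed.

Lemma cm_family_le G n s t : cm_family G -> 0 < s -> s <= t -> G n t <= G n s.
Proof.
move=> cmG s0; rewrite le_eqVlt => /predU1P[->//|st].
have pos x : x \in `[s, t]%R -> 0 < x.
  by rewrite in_itv /= => /andP[/(lt_le_trans s0)].
have dG x : x \in `]s, t[%R -> is_derive x 1 (G n) (- G n.+1 x).
  by move=> xst; apply: (cmG n x (pos x (subset_itv_oo_cc xst))).2.
have cG : {within `[s, t], continuous (G n)}.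
  apply: continuous_in_subspaceT => x; rewrite inE => /pos x0.
  exact: cm_family_continuous.
have [c cst E] := MVT st dG cG.
have /pos c0 := subset_itv_oo_cc cst.
rewrite -subr_le0 E mulNr oppr_le0 mulr_ge0 ?subr_ge0 ?(ltW st) //.
by have [] := cmG n.+1 c c0.
Qed.

Lemma cm_family_diff G h : cm_family G -> 0 < h ->
  cm_family (fun n t => G n t - G n (t + h)).
Proof.
move=> cmG h0 n t t0; have th0 : 0 < t + h by rewrite addr_gt0.
rewrite subr_ge0 cm_family_le ?lerDl ?(ltW h0) //; split => //.
have [_ dG] := cmG n t t0; have [_ dGh] := cmG n (t + h) th0.
have dS : is_derive t 1 (G n \o shift h) (- G n.+1 (t + h)).
  rewrite -[- G n.+1 (t + h)]mulr1.
  by apply: is_derive1_comp => //; apply: is_derive_shift.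
by rewrite opprB addrC -[G n.+1 (t + h)]opprK; apply: is_deriveB.
Qed.

(** Induction on the order of the difference: the first differences of the samples of [G] are
    samples of the family of [cm_family_diff]. *)
Lemma cm_family_cm_seq G h x : cm_family G -> 0 < h -> 0 < x ->
  cm_seq (fun k => G 0%N (x + k%:R * h)).
Proof.
move=> + h0 + k n; elim: k G x n => [|k IHk] G x n cmG x0.
  rewrite /fdiff /=; apply: (cmG 0%N _ _).1.
  by rewrite ltr_wpDr // mulr_ge0 // ltW.
have := IHk _ x n (cm_family_diff cmG h0) x0.
rewrite /fdiff iterSr; congr (0 <= _); apply: eq_fdiff => m.
by rewrite -addrA -natr1 mulrDl mul1r.
Qed.

End CompletelyMonotoneFamily.

Section CompletelyMonotone.
Context {R : realType}.
Implicit Types (g : R -> R).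

Lemma cm_ge0 g t : completely_monotone g -> 0 < t -> 0 <= g t.
Proof. by move=> /(_ 0%N t) cmg /cmg[_]; rewrite expr0 mul1r. Qed.

Lemma cm_noninc g s t : completely_monotone g -> 0 < s -> s <= t -> g t <= g s.
Proof.
move=> cmg s0 st; have := cm_family_le 0 (cm_family_of_cm cmg) s0 st.
by rewrite expr0 !mul1r.
Qed.

Lemma cm_continuous g t : completely_monotone g -> 0 < t ->
  {for t, continuous g}.
Proof.
move=> cmg t0; apply/differentiable_continuous/derivable1_diffP.
by have [] := cmg 0%N t t0.
Qed.

Lemma cm_cm_seq g h : completely_monotone g -> 0 < h ->
  cm_seq (fun k => g (k.+1%:R * h)).
Proof.
move=> cmg h0 k n; have := cm_family_cm_seq (cm_family_of_cm cmg) h0 h0 k n.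
congr (0 <= _); apply: eq_fdiff => m.
by rewrite expr0 mul1r derive1n0 -natr1 mulrDl mul1r addrC.
Qed.

(** Log-convexity of samples stands in for analyticity. With step t0/2 the first two samples are
    positive, hence all are, and some grid point lies beyond t. *)
Lemma cm_gt0 g t0 : completely_monotone g -> 0 < t0 -> g t0 != 0 ->
  forall t, 0 < t -> 0 < g t.
Proof.
move=> cmg t00 gt00 t t_gt0; pose h := t0 / 2; have h0 : 0 < h by rewrite divr_gt0.
have gt0_gt0 : 0 < g t0 by rewrite lt_def gt00 cm_ge0.
have pos := cm_seq_gt0 (cm_cm_seq cmg h0).
have g1 : 0 < g (1%:R * h).
  by rewrite (lt_le_trans gt0_gt0) // cm_noninc // mul1r // /h; lra.
have g2 : 0 < g (2%:R * h) by rewrite /h mulrC divfK.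
pose n := Num.bound (t / h).
have tn : t <= n.+1%:R * h.
  rewrite -ler_pdivrMr // ltW // (lt_trans (archi_boundP _)) ?ltr_nat //.
  by rewrite divr_ge0 ?ltW.
exact: lt_le_trans (pos g1 g2 n) (cm_noninc cmg t_gt0 tn).
Qed.

End CompletelyMonotone.

Section UltraLimit.
Context {R : realType} {T : Type}.

(** By compactness of [0, C] there is a cluster point, and an ultrafilter converges to its cluster
    points. *)
Lemma ultra_bounded_cvg (U : set_system T) (u : T -> R) (C : R) :
  UltraFilter U -> (\forall x \near U, 0 <= u x <= C) -> cvg (u @ U).
Proof.
move=> ultraU uC; have PU : ProperFilter U by exact: ultra_proper.
have [] := @segment_compact R 0 C (u @ U) _ _.
  by apply: filterS uC => x ux /=; rewrite in_itv.
move=> l [_ cl]; apply/cvg_ex; exists l => A Al.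
have [//|nA] := in_ultra_setVsetC (u @^-1` A) ultraU.
by have [x [nAx Ax]] := cl (~` A) A nA Al.
Qed.

End UltraLimit.

Section SecantSlope.
Context {R : realType}.

(* [H] squeezes the secant slopes of [- G], and the second bound makes [H]
   locally Lipschitz. *)
Lemma is_derive_secant (G H K : R -> R) :
  (forall t, 0 < t -> 0 <= K t) ->
  (forall s t, 0 < s -> s < t ->
    (t - s) * H t <= G s - G t <= (t - s) * H s) ->
  (forall s t, 0 < s -> s < t ->
    (t - s) * K t <= H s - H t <= (t - s) * K s) ->
  forall t : R, 0 < t -> is_derive t 1 G (- H t).
Proof.
move=> K0 GH HK t t0.
suff q : (fun h => h^-1 *: ((G \o shift t) (h *: (1 : R)) - G t)) @ 0^' --> - H t.
  by apply: DeriveDef; [apply/cvg_ex; exists (- H t)|exact: cvg_lim].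
have t20 : 0 < t / 2 by rewrite divr_gt0.
have K1 : 0 < K (t / 2) + 1 by rewrite ltr_wpDl ?K0.
apply/cvgrPdist_lt => e e0; near=> h.
have h0 : h != 0 by near: h; exact: nbhs_dnbhs_neq.
have ht : `|h| < t / 2 by near: h; apply: dnbhs0_lt.
have he : `|h| < e / (K (t / 2) + 1) by near: h; apply: dnbhs0_lt; rewrite divr_gt0.
rewrite /GRing.scale /= mulr1.
have [H1 H2] : 0 < t + h /\ t / 2 < t + h.
  by move: ht; rewrite ltr_norml => /andP[]; split; lra.
suff : `|- H t - h^-1 * (G (h + t) - G t)| <= `|h| * (K (t / 2) + 1).
  by move/le_lt_trans; apply; rewrite -ltr_pdivlMr.
(* The bounds on [H] force [K] to be nonincreasing, so one constant serves beyond t/2; the added 1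
   keeps it positive. *)
have KK s : t / 2 < s -> K s <= K (t / 2) + 1.
  move=> st; have := HK _ _ t20 st => /andP[a1 a2].
  have : K s <= K (t / 2).
    by rewrite -(@ler_pM2l _ (s - t / 2)) ?subr_gt0 // (le_trans a1).
  by lra.
have -> : - H t - h^-1 * (G (h + t) - G t) =
    h^-1 * ((G t - G (t + h)) - h * H t) by rewrite (addrC t h); field.
rewrite normrM normfV -ler_pdivlMl ?invr_gt0 ?normr_gt0 // invrK.
case: (ltgtP h 0) h0 => // hs _.
- have /andP[a1 a2] := GH (t + h) t H1 ltac:(lra).
  have /andP[b1 b2] := HK (t + h) t H1 ltac:(lra).
  have b3 := KK _ H2; rewrite (ltr0_norm hs) mulrA mulNr mulrN opprK ler_norml.
  have c1 : - h * K (t + h) <= - h * (K (t / 2) + 1) by rewrite ler_wpM2l //; lra.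
  have c2 : - h * (H (t + h) - H t) <= - h * (- h * (K (t / 2) + 1)).
    by rewrite ler_wpM2l //; lra.
  have d0 : 0 <= h * h * (K (t / 2) + 1).
    by rewrite mulr_ge0 ?(ltW K1) // -expr2 sqr_ge0.
  apply/andP; split; nra.
- have /andP[a1 a2] := GH t (t + h) t0 ltac:(lra).
  have /andP[b1 b2] := HK t (t + h) t0 ltac:(lra).
  have b3 : K t <= K (t / 2) + 1 by apply: KK; lra.
  rewrite (gtr0_norm hs) mulrA ler_norml.
  have c1 : h * K t <= h * (K (t / 2) + 1) by rewrite ler_wpM2l //; lra.
  have c2 : h * (H t - H (t + h)) <= h * (h * (K (t / 2) + 1)).
    by rewrite ler_wpM2l //; lra.
  have d0 : 0 <= h * h * (K (t / 2) + 1).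
    by rewrite mulr_ge0 ?(ltW K1) // -expr2 sqr_ge0.
  apply/andP; split; nra.
Unshelve. all: by end_near. Qed.

End SecantSlope.

Section FiniteDifferences.
Context {R : archiRealFieldType}.
Implicit Type a : nat -> R.

Lemma fdiffS k a n : fdiff k.+1 a n = fdiff k a n - fdiff k a n.+1.
Proof. by []. Qed.

Lemma cm_seq_fdiff k a : cm_seq a -> cm_seq (fdiff k a).
Proof. by move=> cma j n; rewrite /fdiff -iterD; apply: cma. Qed.

(** Discrete convexity: the difference is a sum of m-n first differences, which decrease. *)
Lemma cm_seq_secant a n m : cm_seq a -> (n <= m)%N ->
  (m - n)%:R * fdiff 1 a m <= a n - a m <= (m - n)%:R * fdiff 1 a n.
Proof.
move=> cma; elim: m => [|m IHm].
  by rewrite leqn0 => /eqP ->; rewrite subnn !mul0r subrr lexx.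
rewrite leq_eqVlt => /predU1P[->|lenm].
  by rewrite subnn !mul0r subrr lexx.
have /andP[lo up] := IHm lenm; rewrite subSn // -natr1 !mulrDl !mul1r.
have le1 := cm_seq_noninc (cm_seq_fdiff 1 cma).
have -> : a n - a m.+1 = (a n - a m) + fdiff 1 a m by rewrite fdiffS addrA subrK.
apply/andP; split; apply: lerD => //; last exact: le1.
  by apply: le_trans lo; rewrite ler_wpM2l // le1.
exact: le1.
Qed.

End FiniteDifferences.

(** * Limits of rescaled completely monotone sequences *)

Section DiscreteLimit.
Context {R : realType}.

Lemma cvg_natinv : (fun N : nat => N%:R^-1 : R) @ \oo --> (0 : R).
Proof.
apply/(gtr0_cvgV0 (f := fun N : nat => N%:R)); last exact: cvgr_idn.
by exists 1%N => // N /= N0; rewrite ltr0n.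
Qed.

Variable c : nat -> nat -> R.
Hypothesis cmc : forall N, cm_seq (c N).

(** One factor N turns the mass of a cell of width 1/N into a density; the k others turn differences
    into difference quotients, so that [F k N] approximates $(-1)^k f^{(k)}$. *)
Let F (k N : nat) (t : R) : R :=
  N%:R ^+ k.+1 * fdiff k (c N) (Num.truncn (t * N%:R)).

Let F_ge0 k N t : 0 <= F k N t.
Proof. by rewrite mulr_ge0 ?exprn_ge0 //; apply: cmc. Qed.

(** The terms 1/N absorb the rounding: the integer parts of tN and sN differ from each other by
    (t-s)N up to 1. *)
Let F_secant k N (s t : R) : (0 < N)%N -> 0 <= s -> s <= t ->
  (t - s - N%:R^-1) * F k.+1 N t <= F k N s - F k N t
    <= (t - s + N%:R^-1) * F k.+1 N s.
Proof.
move=> N0 s0 st; have NR : 0 < N%:R :> R by rewrite ltr0n.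
have sN0 : 0 <= s * N%:R by rewrite mulr_ge0.
have stN : s * N%:R <= t * N%:R by rewrite ler_wpM2r.
have /andP[n1 n2] := truncn_itv sN0.
have /andP[m1 m2] := truncn_itv (le_trans sN0 stN).
rewrite /F; move: (le_truncn stN) n1 n2 m1 m2.
move: (Num.truncn (s * N%:R)) (Num.truncn (t * N%:R)) => n m nm n1 n2 m1 m2.
have /andP[lo up] := cm_seq_secant (cm_seq_fdiff k (cmc N)) nm.
have E x j : (x + N%:R^-1) * (N%:R ^+ k.+2 * fdiff k.+1 (c N) j) =
    N%:R ^+ k.+1 * ((x * N%:R + 1) * fdiff k.+1 (c N) j).
  by rewrite [_ ^+ k.+2]exprS; field; rewrite gt_eqF.
have E' x j : (x - N%:R^-1) * (N%:R ^+ k.+2 * fdiff k.+1 (c N) j) =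
    N%:R ^+ k.+1 * ((x * N%:R - 1) * fdiff k.+1 (c N) j).
  by rewrite [_ ^+ k.+2]exprS; field; rewrite gt_eqF.
rewrite E E' -mulrBr !(ler_pM2l (exprn_gt0 _ NR)).
move: n2 m2; rewrite -!natr1 => n2 m2; rewrite natrB // in lo up.
have g0 j : 0 <= fdiff k.+1 (c N) j by apply: cmc.
apply/andP; split; [apply: le_trans lo|apply: le_trans up _].
  by apply: (ler_wpM2r (g0 m)); lra.
by apply: (ler_wpM2r (g0 n)); lra.
Qed.

Hypothesis bdc : forall t : R, 0 < t -> exists C,
  \forall N \near \oo, N%:R * c N (Num.truncn (t * N%:R)) <= C.

Let F_bound k (t : R) : 0 < t -> exists C, \forall N \near \oo, F k N t <= C.
Proof.
elim: k t => [|k IHk] t t0.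
  by have [C hC] := bdc t0; exists C; near=> N; rewrite /F expr1; near: N.
have t20 : 0 < t / 2 by rewrite divr_gt0.
(* The secant bound on [t/2, t], whose length is still at least t/4 after the loss of 1/N, controls
   order k+1 at t by order k at t/2. *)
have [C hC] := IHk _ t20; exists (C / (t / 4)); near=> N.
have N0 : (0 < N)%N by near: N; exists 1%N.
have Nt : N%:R^-1 <= t / 4.
  rewrite -[t / 4]invrK lef_pV2 ?posrE ?invr_gt0 ?divr_gt0 ?ltr0n //.
  by near: N; exact: nbhs_infty_ger.
have FC : F k N (t / 2) <= C by near: N.
have /andP[h _] := @F_secant k N (t / 2) t N0 (ltW t20) ltac:(lra).
rewrite ler_pdivlMr ?divr_gt0 // mulrC.
apply: le_trans (_ : (t - t / 2 - N%:R^-1) * F k.+1 N t <= _).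
  by rewrite ler_wpM2r //; lra.
by have := F_ge0 k N t; lra.
Unshelve. all: by end_near. Qed.

(** One ultrafilter makes all [F k N t] converge at once, for every k and every real t > 0. The
    limits satisfy the secant inequalities without the 1/N, so [is_derive_secant] links consecutive
    orders. *)
Lemma cm_seq_ultra_limit :
  exists U f, [/\ UltraFilter U, \oo `<=` U, completely_monotone f &
    forall t : R, 0 < t ->
      (fun N => N%:R * c N (Num.truncn (t * N%:R))) @ U --> f t].
Proof.
have [U [ultraU ooU]] := @ultraFilterLemma _ (\oo : set_system nat) _.
have PU : ProperFilter U by exact: ultra_proper.
pose G k t := lim (F k ^~ t @ U).
have cvG k t : 0 < t -> F k ^~ t @ U --> G k t.
  move=> t0; have [C hC] := F_bound k t0.
  apply: (@ultra_bounded_cvg _ _ U _ C) => //.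
  by apply: ooU; near=> N; rewrite F_ge0 /=; near: N.
have G0 k t : 0 < t -> 0 <= G k t.
  move=> t0; apply: limr_ge; first exact: cvgP (cvG k t t0).
  exact: nearW.
have Ninv : (fun N => N%:R^-1 : R) @ U --> (0 : R).
  by apply: cvg_trans cvg_natinv => A; apply: ooU.
have Gsec k s t : 0 < s -> s < t ->
    (t - s) * G k.+1 t <= G k s - G k t <= (t - s) * G k.+1 s.
  move=> s0 st; have t0 := lt_trans s0 st.
  have c1 : (fun N => F k N s - F k N t) @ U --> G k s - G k t.
    by apply: cvgB; exact: cvG.
  have c2 : (fun N => (t - s - N%:R^-1) * F k.+1 N t) @ U --> (t - s) * G k.+1 t.
    rewrite -[X in X * G _ _]subr0; apply: cvgM; last exact: cvG.
    by apply: cvgB => //; exact: cvg_cst.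
  have c3 : (fun N => (t - s + N%:R^-1) * F k.+1 N s) @ U --> (t - s) * G k.+1 s.
    rewrite -[X in X * G _ _]addr0; apply: cvgM; last exact: cvG.
    by apply: cvgD => //; exact: cvg_cst.
  have sec : \forall N \near U, (t - s - N%:R^-1) * F k.+1 N t <= F k N s - F k N t
      <= (t - s + N%:R^-1) * F k.+1 N s.
    by apply: ooU; exists 1%N => // N /= N0; apply: F_secant => //; exact: ltW.
  apply/andP; split.
    by apply: (ler_cvg_to c2 c1); apply: filterS sec => N /andP[].
  by apply: (ler_cvg_to c1 c3); apply: filterS sec => N /andP[].
exists U, (G 0%N); split => //.
  apply: cm_of_cm_family => k t t0; split; first exact: G0.
  exact: (is_derive_secant (G0 k.+2) (Gsec k) (Gsec k.+1)).
by move=> t t0; have := cvG 0%N t t0; under eq_fun do rewrite /F expr1.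
Unshelve. all: by end_near. Qed.

End DiscreteLimit.

Section PointwiseSubsequence.
Context {R : realType}.

(* Pointwise limits along an ultrafilter of nonincreasing functions with a
   continuous limit are limits of a subsequence: extract it on the rationals
   and squeeze. *)
Lemma noninc_ultra_subseq (U : set_system nat) (F : nat -> R -> R) (f : R -> R) :
  UltraFilter U -> \oo `<=` U ->
  (forall N s t, 0 < s -> s <= t -> F N t <= F N s) ->
  (forall t : R, 0 < t -> {for t, continuous f}) ->
  (forall t : R, 0 < t -> F ^~ t @ U --> f t) ->
  exists phi : nat -> nat, (forall i, (i < phi i)%N) /\
    forall t : R, 0 < t -> (fun i => F (phi i) t) @ \oo --> f t.
Proof.
move=> ultraU ooU dF cf Ff; have PU : ProperFilter U by exact: ultra_proper.
(* An enumeration of the rationals; codes of no rational are sent to the harmless value 1. *)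
pose q j : R := if @unpickle rat j is Some r then ratr r else 1.
pose P i N := (i < N)%N /\ forall j, (j <= i)%N -> 0 < q j ->
  `|f (q j) - F N (q j)| < i.+1%:R^-1.
have Pex i : exists N, P i N.
  suff : U (P i) by move=> /filter_ex.
  apply: filterI; first by apply: ooU; exists i.+1.
  suff H m : U [set N | forall j, (j < m)%N -> 0 < q j ->
      `|f (q j) - F N (q j)| < i.+1%:R^-1].
    by apply: filterS (H i.+1) => N HN j ji; apply: HN.
  elim: m => [|m IHm]; first by apply: filterS filterT => N _ j.
  have [q0|q0] := ltP 0 (q m); last first.
    apply: filterS IHm => N HN j; rewrite ltnS leq_eqVlt => /predU1P[->|/HN//].
    by move/(le_lt_trans q0); rewrite ltxx.
  have Fq : U [set N | `|f (q m) - F N (q m)| < i.+1%:R^-1].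
    by move/cvgrPdist_lt : (Ff _ q0); apply; rewrite invr_gt0.
  apply: filterS2 IHm Fq => N HN HNm j.
  by rewrite ltnS leq_eqVlt => /predU1P[->|/HN//].
have [phi Pphi] := choice Pex.
exists phi; split=> [i|t t0]; first by have [] := Pphi i.
have cvq (r : rat) e : 0 < ratr r :> R -> 0 < e ->
    \forall i \near \oo, `|f (ratr r) - F (phi i) (ratr r)| < e.
  move=> r0 e0.
  have qE : q (pickle r) = ratr r by rewrite /q pickleK.
  near=> i; have [_ /(_ (pickle r))] := Pphi i; rewrite qE => H.
  apply: lt_trans (H _ r0) _; first by near: i; exists (pickle r).
  rewrite invf_plt ?posrE //; near: i.
  have [M _ HM] := @nbhs_infty_ger R e^-1.
  by exists M => // i Mi; rewrite (le_lt_trans (HM i Mi)) // ltr_nat.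
apply/cvgrPdist_lt => e e0.
have e2 : 0 < e / 2 by rewrite divr_gt0.
have /cvgrPdist_lt/(_ _ e2) := cf t t0.
move=> /nbhs_ballP[d /= d0 Hd].
have close x : `|t - x| < d -> `|f t - f x| < e / 2 by move=> xd; apply: Hd.
(* Rationals r1 < t < r2 close to t: by monotonicity the values at t are squeezed between those at
   r1 and r2. *)
have [r1 ] := rat_in_itvoo (ltac:(rewrite gt_max; apply/andP; split; lra) :
  Num.max (t / 2) (t - d) < t).
rewrite in_itv /= gt_max => /andP[/andP[r1a r1b] r1t].
have [r2] := rat_in_itvoo (ltac:(lra) : t < t + d).
rewrite in_itv /= => /andP[tr2 r2d].
have r10 : 0 < ratr r1 :> R by lra.
have := close (ratr r1) ltac:(rewrite ger0_norm; lra).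
have := close (ratr r2) ltac:(rewrite ler0_norm; lra).
rewrite !ltr_norml => /andP[_ f2] /andP[f1 _].
near=> i.
have /ltr_normlP[g1 g1'] : `|f (ratr r1) - F (phi i) (ratr r1)| < e / 2.
  by near: i; exact: cvq.
have /ltr_normlP[g2 g2'] : `|f (ratr r2) - F (phi i) (ratr r2)| < e / 2.
  by near: i; apply: cvq => //; lra.
have m1 := dF (phi i) _ _ r10 (ltW r1t).
have m2 := dF (phi i) _ _ t0 (ltW tr2).
rewrite ltr_norml; apply/andP; split; lra.
Unshelve. all: by end_near. Qed.

(** A genuine subsequence is wanted because dominated convergence is about sequences, not about
    ultrafilters. *)
Lemma cm_seq_subseq_limit (c : nat -> nat -> R) :
  (forall N, cm_seq (c N)) ->
  (forall t : R, 0 < t -> exists C,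
    \forall N \near \oo, N%:R * c N (Num.truncn (t * N%:R)) <= C) ->
  exists f phi, [/\ completely_monotone f, forall i : nat, (i < phi i)%N &
    forall t : R, 0 < t ->
      (fun i => (phi i)%:R * c (phi i) (Num.truncn (t * (phi i)%:R))) @ \oo
        --> f t].
Proof.
move=> cmc bdc; have [U [f [ultraU ooU cmf Ff]]] := cm_seq_ultra_limit cmc bdc.
have [|t|phi [phiE phiF]] := noninc_ultra_subseq ultraU ooU _ _ Ff.
- move=> N s t s0 st; rewrite ler_wpM2l //; apply: cm_seq_noninc => //.
  by apply: le_truncn; rewrite ler_wpM2r.
- exact: cm_continuous.
- by exists f, phi.
Qed.

End PointwiseSubsequence.

(** * Passage to the limit in the convolution equation *)

Section ReciprocalSequence.
Context {R : archiRealFieldType}.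
Variables a c : nat -> R.
Hypotheses (cma : cm_seq a) (cmc : cm_seq c) (a_gt0 : forall n, 0 < a n).
Hypothesis ac1 : forall n, \sum_(k < n.+1) a (n - k) * c k = 1.

Let ac1_rev n : \sum_(0 <= j < n.+1) a j * c (n - j) = 1.
Proof.
rewrite -(ac1 n) -(big_mkord xpredT (fun k => a (n - k) * c k)) big_nat_rev /=.
by apply: eq_big_nat => j ltj; rewrite add0n subSS subKn.
Qed.

Lemma reciprocal0 : c 0%N = (a 0%N)^-1.
Proof.
apply: (mulfI (lt0r_neq0 (a_gt0 0))).
by rewrite mulfV ?gt_eqF // -(ac1_rev 0) big_nat1.
Qed.


(** Both sequences are nonincreasing, so each of the n+1 terms of the sum is at least $a_n c_n$. *)
Lemma reciprocal_le n : n.+1%:R * (a n * c n) <= 1.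
Proof.
rewrite -[X in _ <= X](ac1 n) mulr_natl -[X in _ *+ X](card_ord n.+1) -sumr_const.
apply: ler_sum => k _; apply: ler_pM; rewrite ?(ltW (a_gt0 _)) ?cm_seq_ge0 //.
  by rewrite cm_seq_noninc ?leq_subr.
by rewrite cm_seq_noninc // -ltnS.
Qed.

(** The tail runs over $J \le j \le n$. Its last term is $a_n c_0 = a_n/a_0$; in the others $a_j \le
    a_J$, and the equation of index n-J bounds the sum of the $c_{n-j}$, with $c_0$ included, by
    $1/a_{n-J}$. *)
Lemma reciprocal_tail J n : (J <= n)%N ->
  a n / a 0%N <= 1 - \sum_(j < J) a j * c (n - j)
    <= a n / a 0%N + a J * ((a (n - J)%N)^-1 - (a 0%N)^-1).
Proof.
move=> leJn; set S := \sum_(j < J) _.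
have -> : 1 - S = \sum_(J <= j < n.+1) a j * c (n - j).
  rewrite -(ac1_rev n) (big_cat_nat (n := J)) //=; last exact: leqW.
  by rewrite big_mkord addrAC subrr add0r.
have sumc : \sum_(J <= j < n.+1) c (n - j) <= (a (n - J)%N)^-1.
  rewrite -div1r ler_pdivlMr // -(ac1_rev (n - J)) -{1}(add0n J) big_addn subSn //.
  rewrite mulr_suml; apply: ler_sum_nat => j /andP[_ ltj].
  rewrite mulrC (addnC j) subnDA; apply: ler_wpM2r; first exact: cm_seq_ge0.
  exact: cm_seq_noninc.
move: sumc; rewrite !(@big_nat_recr _ _ _ n J) //= subnn reciprocal0 => sumc.
rewrite lerDr [X in _ && (X <= _)]addrC lerD2l sumr_ge0 /=; last first.
  by move=> j _; rewrite mulr_ge0 ?(ltW (a_gt0 _)) ?cm_seq_ge0.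
rewrite -lerBrDr in sumc; apply: le_trans (ler_wpM2l (ltW (a_gt0 _)) sumc).
rewrite mulr_sumr; apply: ler_sum_nat => j /andP[leJj _].
by rewrite ler_wpM2r ?cm_seq_ge0 // cm_seq_noninc.
Qed.

End ReciprocalSequence.

(** * Step functions on the grid of mesh 1/N *)

Section GridStepFunction.
Context {R : realType}.
Local Notation mu := (@lebesgue_measure R).

Definition grid_cell (N j : nat) : set R := `[j%:R / N%:R, j.+1%:R / N%:R[%classic.

(** A finite sum of indicators, rather than a composition with [Num.truncn], so that measurability
    and the integral are obtained termwise. *)
Definition grid_step (N J : nat) (w : nat -> R) (x : R) : R :=
  \sum_(j < J) w j * \1_(grid_cell N j) x.

Lemma mem_grid_cell N j (x : R) : (0 < N)%N -> 0 <= x ->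
  (x \in grid_cell N j) = (Num.truncn (x * N%:R) == j).
Proof.
move=> N0 x0; have NR : 0 < N%:R :> R by rewrite ltr0n.
rewrite truncn_eq ?mulr_ge0 // mem_setE in_itv /=.
by rewrite ler_pdivrMr // ltr_pdivlMr.
Qed.

Lemma grid_stepE N J w (x : R) : (0 < N)%N -> 0 <= x ->
  grid_step N J w x =
  if (Num.truncn (x * N%:R) < J)%N then w (Num.truncn (x * N%:R)) else 0.
Proof.
move=> N0 x0; rewrite /grid_step.
under eq_bigr => j _ do rewrite indicE mem_grid_cell //.
case: ifPn => [lt|]; last first.
  rewrite -leqNgt => le; rewrite big1 // => j _.
  by rewrite gtn_eqF ?mulr0 // (leq_trans (ltn_ord j)).
rewrite (bigD1 (Ordinal lt)) //= eqxx mulr1 big1 ?addr0 // => j.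
by rewrite -val_eqE /= eq_sym => /negbTE ->; rewrite mulr0.
Qed.

Lemma measurable_grid_step N J w D : measurable_fun D (@grid_step N J w).
Proof.
apply: measurable_sum => j; apply: measurable_funM => //.
by apply: measurable_indic; exact: measurable_itv.
Qed.

Lemma integral_grid_step N J w (s : R) : (0 < N)%N -> J%:R <= s * N%:R ->
  (forall j, 0 <= w j) ->
  (\int[mu]_(x in `[0%R, s[) (grid_step N J w x)%:E)%E =
  (\sum_(j < J) w j / N%:R)%:E.
Proof.
move=> N0 Js w0; have NR : 0 < N%:R :> R by rewrite ltr0n.
under eq_integral do rewrite /grid_step -sumEFin.
rewrite ge0_integral_sum //; last 2 first.
- move=> j; apply/measurable_EFinP; apply: measurable_funM => //.
  by apply: measurable_indic; exact: measurable_itv.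
- by move=> j x _; rewrite lee_fin mulr_ge0.
rewrite -sumEFin; apply: eq_bigr => j _.
under eq_integral do rewrite EFinM.
rewrite ge0_integralZl_EFin //; last first.
  by apply/measurable_EFinP/measurable_indic; exact: measurable_itv.
rewrite integral_indic //; last exact: measurable_itv.
rewrite EFinM; congr (_ * _)%E; rewrite setIidl.
  rewrite /grid_cell /= lebesgue_measure_itv /= lte_fin ltr_pM2r ?invr_gt0 //.
  by rewrite ltr_nat ltnSn -EFinB -mulrBl -natr1 addrAC subrr add0r mul1r.
move=> x; rewrite /grid_cell /= !in_itv /= => /andP[x1 x2]; apply/andP; split.
  by apply: le_trans x1; rewrite divr_ge0.
apply: lt_le_trans x2 _; rewrite ler_pdivrMr // (le_trans _ Js) // ler_nat.
exact: ltn_ord.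
Qed.

End GridStepFunction.

Lemma truncn_subr (R : archiRealDomainType) (x y : R) : 0 <= x -> x <= y ->
  (Num.truncn (y - x) <= Num.truncn y - Num.truncn x <= (Num.truncn (y - x)).+1)%N.
Proof.
move=> x0 xy; have y0 := le_trans x0 xy.
have yx0 : 0 <= y - x by rewrite subr_ge0.
have /andP[x1 x2] := truncn_itv x0; have /andP[y1 y2] := truncn_itv y0.
have /andP[z1 z2] := truncn_itv yx0.
move: x1 x2 y1 y2 z1 z2.
move: (Num.truncn x) (Num.truncn y) (Num.truncn (y - x)) => a b d.
rewrite -!natr1 => x1 x2 y1 y2 z1 z2.
have h1 : d%:R + a%:R < b%:R + 1 :> R by lra.
have h2 : b%:R < d%:R + a%:R + 1 + 1 :> R by lra.
rewrite -natrD natr1 ltr_nat in h1; rewrite -natrD !natr1 ltr_nat in h2.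
by lia.
Qed.

(** * Dominated convergence on ]0, s[ for s < t *)

Section ConvolutionLimit.
Context {R : realType}.
Local Notation mu := (@lebesgue_measure R).
Variables (g f : R -> R) (c : nat -> nat -> R) (phi : nat -> nat).
Hypotheses (cmg : completely_monotone g) (g_gt0 : forall t, 0 < t -> 0 < g t).
Hypothesis gL1 : L1loc g.
Hypothesis cmc : forall N, cm_seq (c N).
Hypothesis gc1 : forall N, (0 < N)%N -> forall n,
  \sum_(k < n.+1) g ((n - k).+1%:R / N%:R) * c N k = 1.

Let cma N : (0 < N)%N -> cm_seq (fun k => g (k.+1%:R / N%:R)).
Proof. by move=> N0; apply: cm_cm_seq; rewrite // invr_gt0 ltr0n. Qed.

Let a_gt0 N : (0 < N)%N -> forall n, 0 < g (n.+1%:R / N%:R).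
Proof. by move=> N0 n; rewrite g_gt0 // divr_gt0 // ltr0n. Qed.

(** Take [reciprocal_le] at the integer part n of tN: n+1 > tN and (n+1)/N <= t+1. The bound is free
    of N, so it serves both for the extraction of a limit and for domination. *)
Lemma scaled_reciprocal_le N (t : R) : (0 < N)%N -> 0 < t ->
  N%:R * c N (Num.truncn (t * N%:R)) <= (t * g (t + 1))^-1.
Proof.
move=> N0 t0; have NR : 0 < N%:R :> R by rewrite ltr0n.
have t10 : 0 < t + 1 by rewrite addr_gt0.
have tN0 : 0 <= t * N%:R by rewrite mulr_ge0 ?ltW.
have /andP[n1 n2] := truncn_itv tN0; set n := Num.truncn _ in n1 n2 *.
have /= := reciprocal_le (cma N0) (cmc N) (a_gt0 N0) (gc1 N0) n.
apply: contraTT; rewrite -!ltNge => lt1.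
have cn0 : 0 <= c N n by apply: cm_seq_ge0.
have lt2 : 1 < N%:R * c N n * (t * g (t + 1)).
  by rewrite -ltr_pdivrMr ?mulr_gt0 ?g_gt0 // div1r.
apply: (lt_le_trans lt2).
have -> : N%:R * c N n * (t * g (t + 1)) = (t * N%:R) * (g (t + 1) * c N n) by ring.
apply: ler_pM => //; first by rewrite mulr_ge0 // ltW ?g_gt0.
  exact: ltW.
rewrite ler_wpM2r // cm_noninc ?divr_gt0 ?ltr0n //.
by rewrite ler_pdivrMr // mulrDl mul1r -natr1 lerD // ler1n.
Qed.

Hypothesis cmf : completely_monotone f.
Hypothesis phi_gt : forall i, (i < phi i)%N.
Hypothesis phif : forall t : R, 0 < t ->
  (fun i => (phi i)%:R * c (phi i) (Num.truncn (t * (phi i)%:R))) @ \oo --> f t.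

Let phi0 i : (0 < phi i)%N. Proof. exact: leq_ltn_trans (phi_gt i). Qed.

Let near_phi (M : R) : \forall i \near \oo, M <= (phi i)%:R.
Proof.
near=> i; have : M <= i%:R by near: i; exact: nbhs_infty_ger.
by move/le_trans; apply; rewrite ler_nat ltnW.
Unshelve. all: by end_near. Qed.

Lemma cvg_grid_point (x : R) : 0 < x ->
  (fun i => g ((Num.truncn (x * (phi i)%:R)).+1%:R / (phi i)%:R)) @ \oo --> g x.
Proof.
move=> x0; have NR i : 0 < (phi i)%:R :> R by rewrite ltr0n.
suff cx : (fun i => (Num.truncn (x * (phi i)%:R)).+1%:R / (phi i)%:R) @ \oo --> x.
  exact: (continuous_cvg _ (cm_continuous cmg x0) cx).
apply/cvgrPdist_le => e e0; near=> i.
have xN0 : 0 <= x * (phi i)%:R by rewrite mulr_ge0 ?ltW.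
have /andP[j1 j2] := truncn_itv xN0.
have eN : e^-1 <= (phi i)%:R by near: i; exact: near_phi.
have N1 : (phi i)%:R^-1 <= e by rewrite -[e]invrK lef_pV2 ?posrE ?invr_gt0.
rewrite distrC ger0_norm; last by rewrite subr_ge0 ler_pdivlMr // ltW.
rewrite lerBlDl ler_pdivrMr // mulrDl -natr1 lerD //.
by rewrite -ler_pdivrMr // div1r.
Unshelve. all: by end_near. Qed.

Variables (s t : R).
Hypotheses (s0 : 0 < s) (st : s < t).

Let w (N : nat) (j : nat) : R :=
  N%:R * (g (j.+1%:R / N%:R) * c N (Num.truncn (t * N%:R) - j)%N).
Let u (N : nat) : R -> R := grid_step N (Num.truncn (s * N%:R)) (w N).

Let w_ge0 N j : (0 < N)%N -> 0 <= w N j.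
Proof.
by move=> N0; rewrite !mulr_ge0 ?(ltW (a_gt0 N0 _)) //; apply: cm_seq_ge0.
Qed.

(** Stopping at s < t keeps the argument of the second factor at least t-s away from 0, where the
    limit [f] may blow up; [g] times a constant then dominates. *)
Let u_dom N (x : R) : (0 < N)%N -> 0 < x -> x < s ->
  0 <= u N x <= g x * ((t - s) * g (t - s + 1))^-1.
Proof.
move=> N0 x0 xs; have NR : 0 < N%:R :> R by rewrite ltr0n.
have gx : 0 <= g x * ((t - s) * g (t - s + 1))^-1.
  rewrite mulr_ge0 ?invr_ge0 ?mulr_ge0 ?subr_ge0 ?(ltW st) ?cm_ge0 //.
  by rewrite addr_gt0 ?subr_gt0.
rewrite /u (grid_stepE _ _ N0 (ltW x0)). case: ifP => _; last by rewrite lexx gx.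
rewrite w_ge0 //= /w mulrCA; have xN0 : 0 <= x * N%:R by rewrite mulr_ge0 ?ltW.
have /andP[_ x2] := truncn_itv xN0.
apply: ler_pM; rewrite ?(ltW (a_gt0 N0 _)) ?mulr_ge0 //; first exact: cm_seq_ge0.
  by rewrite cm_noninc // ler_pdivlMr // ltW.
apply: le_trans (scaled_reciprocal_le N0 _); last by rewrite subr_gt0.
rewrite ler_wpM2l // cm_seq_noninc //.
have xt : x * N%:R <= t * N%:R by rewrite ler_wpM2r // ltW // (lt_trans xs).
have /andP[h _] := truncn_subr xN0 xt; apply: leq_trans h.
by apply: le_truncn; rewrite -mulrBl ler_wpM2r // lerB // ltW.
Qed.

Let u_cvg (x : R) : 0 < x -> x < s ->
  (fun i => u (phi i) x) @ \oo --> g x * f (t - x).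
Proof.
move=> x0 xs; have tx0 : 0 < t - x by rewrite subr_gt0 (lt_trans xs).
pose j i := Num.truncn (x * (phi i)%:R).
pose n i := Num.truncn (t * (phi i)%:R).
have NR i : 0 < (phi i)%:R :> R by rewrite ltr0n.
have xN0 i : 0 <= x * (phi i)%:R by rewrite mulr_ge0 ?ltW.
have xtN i : x * (phi i)%:R <= t * (phi i)%:R.
  by rewrite ler_wpM2r // ltW // (lt_trans xs).
have cg := cvg_grid_point x0.
(* The index n-j is the integer part of (t-x)N or one more, so the value lies between those at
   t-x+d/2 and at t-x; continuity of [f] closes the gap. *)
have cf : (fun i => (phi i)%:R * c (phi i) (n i - j i)%N) @ \oo --> f (t - x).
  apply/cvgrPdist_lt => e e0; have e2 : 0 < e / 2 by rewrite divr_gt0.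
  have /cvgrPdist_lt/(_ _ e2)/nbhs_ballP[d /= d0 Hd] := cm_continuous cmf tx0.
  have d2 : 0 < d / 2 by rewrite divr_gt0.
  have txd : 0 < t - x + d / 2 by rewrite addr_gt0.
  have : `|f (t - x) - f (t - x + d / 2)| < e / 2.
    apply: Hd; rewrite /ball /= opprD addrA subrr add0r normrN gtr0_norm //.
    by rewrite ltr_pdivrMr // ltr_pMr // ltr1n.
  rewrite ltr_norml => /andP[_ f1].
  have /cvgrPdist_lt/(_ _ e2) h1 := phif txd.
  have /cvgrPdist_lt/(_ _ e2) h2 := phif tx0.
  near=> i.
  have : `|f (t - x) -
      (phi i)%:R * c (phi i) (Num.truncn ((t - x) * (phi i)%:R))| < e / 2.
    by near: i.
  have : `|f (t - x + d / 2) - (phi i)%:R *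
      c (phi i) (Num.truncn ((t - x + d / 2) * (phi i)%:R))| < e / 2.
    by near: i.
  rewrite !ltr_norml => /andP[_ l1] /andP[l2 _].
  have /andP[nj1 nj2] := truncn_subr (xN0 i) (xtN i).
  have up : (phi i)%:R * c (phi i) (n i - j i)%N <=
      (phi i)%:R * c (phi i) (Num.truncn ((t - x) * (phi i)%:R)).
    by rewrite ler_wpM2l // cm_seq_noninc // mulrBl.
  have lo : (phi i)%:R * c (phi i) (Num.truncn ((t - x + d / 2) * (phi i)%:R)) <=
      (phi i)%:R * c (phi i) (n i - j i)%N.
    rewrite ler_wpM2l // cm_seq_noninc // (leq_trans nj2) // -mulrBl.
    have tN0 : 0 <= (t - x) * (phi i)%:R by rewrite mulr_ge0 // ltW.
    rewrite truncn_ge_nat; last by rewrite mulr_ge0 // ltW.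
    have /andP[z1 _] := truncn_itv tN0.
    rewrite -natr1 (mulrDl (t - x)) lerD // -ler_pdivrMl // mulr1.
    by near: i; exact: near_phi.
  by apply/andP; split; lra.
apply: cvg_trans (cvgM cg cf); apply: near_eq_cvg; near=> i.
rewrite /u grid_stepE ?phi0 ?ltW // ifT; first by rewrite /w mulrCA.
(* Since x < s, the cell of x is among those summed once N(s-x) >= 1. *)
rewrite -/(j i) truncn_ge_nat; last by rewrite mulr_ge0 // ltW.
have /andP[j1 _] := truncn_itv (xN0 i); rewrite -natr1.
apply: (le_trans (lerD j1 (lexx 1))).
rewrite -lerBrDl -mulrBl -ler_pdivrMl ?subr_gt0 // mulr1.
by near: i; exact: near_phi.
Unshelve. all: by end_near. Qed.

Let S N := \sum_(j < Num.truncn (s * N%:R))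
  g (j.+1%:R / N%:R) * c N (Num.truncn (t * N%:R) - j)%N.

Let integral_u N : (0 < N)%N ->
  (\int[mu]_(x in `]0%R, s[) (u N x)%:E)%E = (S N)%:E.
Proof.
move=> N0; rewrite integral_itv_obnd_cbnd; last first.
  by apply/measurable_EFinP; exact: measurable_grid_step.
rewrite integral_grid_step //; last 2 first.
- by rewrite truncn_le mulr_ge0 // ltW.
- by move=> j; exact: w_ge0.
congr EFin; apply: eq_bigr => j _; rewrite /w; field.
by rewrite pnatr_eq0 -lt0n.
Qed.

Lemma cvg_discrete_conv :
  mu.-integrable `]0, s[ (fun x => (g x * f (t - x))%:E) /\
  (fun i => (S (phi i))%:E) @ \oo -->
    (\int[mu]_(x in `]0%R, s[) (g x * f (t - x))%:E)%E.
Proof.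
pose K := ((t - s) * g (t - s + 1))^-1.
have ig : mu.-integrable `]0, s[ (fun x => (g x * K)%:E).
  have ig : mu.-integrable `]0, s[ (EFin \o g).
    apply: integrableS (gL1 s0); [exact: measurable_itv|exact: measurable_itv|].
    exact: subset_itv_oo_oc.
  have -> : (fun x => (g x * K)%:E) = (fun x => K%:E * (EFin \o g) x)%E.
    by apply/funext => x /=; rewrite mulrC EFinM.
  by apply: integrableZl ig; exact: measurable_itv.
have mgf : measurable_fun `]0, s[ (fun x => (g x * f (t - x))%:E).
  apply/measurable_EFinP; apply: open_continuous_measurable_fun => //.
  move=> x; rewrite inE /= in_itv /= => /andP[x0 xs].
  have tx0 : 0 < t - x by rewrite subr_gt0 (lt_trans xs).
  apply: cvgM; first exact: cm_continuous.
  apply: (@continuous_comp _ _ _ (fun x => t - x) f); last exact: cm_continuous.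
  by apply: cvgB; [exact: cvg_cst|exact: cvg_id].
have [] := @dominated_convergence _ _ _ mu `]0, s[ _
  (fun i x => (u (phi i) x)%:E) (fun x => (g x * f (t - x))%:E)
  (fun x => (g x * K)%:E) _ mgf _ ig _.
- exact: measurable_itv.
- by move=> i; apply/measurable_EFinP; exact: measurable_grid_step.
- apply: aeW => x /=; rewrite in_itv /= => /andP[x0 xs].
  by apply: cvg_EFin; [exact: nearW|exact: u_cvg].
- apply: aeW => x /= i; rewrite in_itv /= => /andP[x0 xs].
  have /andP[u0 uK] := u_dom (phi0 i) x0 xs.
  by rewrite /= lee_fin ger0_norm.
move=> igf _ cvu; split=> //; apply: cvg_trans cvu; apply: near_eq_cvg.
by apply: nearW => i /=; rewrite integral_u.
Qed.


Variable b : R.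
Hypothesis b_le : forall x : R, 0 < x -> b <= (g x)^-1.
Hypothesis b_inf : forall e : R, 0 < e -> exists2 x0 : R, 0 < x0 &
  forall x, 0 < x -> x <= x0 -> (g x)^-1 < b + e.

(* What the truncation at [s] misses: the term of [c_0 = 1/g(1/N)], which tends
   to [b * g t], and a remainder bounded by the second summand. *)
Lemma conv_tail_bounds :
  let I := fine (\int[mu]_(x in `]0%R, s[) (g x * f (t - x))%:E)%E in
  b * g t <= 1 - I <= b * g t + g s * ((g ((t - s) *+ 2))^-1 - b).
Proof.
have [igf cS] := cvg_discrete_conv; set I := (\int[mu]_(x in _) _)%E in cS *.
have t0 := lt_trans s0 st; have ts0 : 0 < t - s by rewrite subr_gt0.
have Ifin : I \is a fin_num by exact: integrable_fin_num igf.
have /fine_cvgP[_ cSr] : (fun i => (S (phi i))%:E) @ \oo --> (fine I)%:E.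
  by rewrite fineK.
have cS1 : (fun i => 1 - S (phi i)) @ \oo --> 1 - fine I.
  by apply: cvgB => //; exact: cvg_cst.
have cgt := cvg_grid_point t0.
pose J i := Num.truncn (s * (phi i)%:R); pose n i := Num.truncn (t * (phi i)%:R).
have sN0 i : 0 <= s * (phi i)%:R by rewrite mulr_ge0 // ltW.
have stN i : s * (phi i)%:R <= t * (phi i)%:R by rewrite ler_wpM2r // ltW.
have leJn i : (J i <= n i)%N by apply: le_truncn.
have tail i := reciprocal_tail (cma (phi0 i)) (cmc (phi i)) (a_gt0 (phi0 i))
  (gc1 (phi0 i)) (leJn i).
have g_ge0 x : 0 < x -> 0 <= g x by move=> x0; exact/ltW/g_gt0.
apply/andP; split.
  have cL : (fun i => b * g ((n i).+1%:R / (phi i)%:R)) @ \oo --> b * g t.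
    by apply: cvgM => //; exact: cvg_cst.
  apply: (ler_cvg_to cL cS1); apply: nearW => i.
  have /andP[lo _] := tail i; apply: le_trans lo.
  by rewrite mulrC ler_wpM2l ?(ltW (a_gt0 (phi0 i) _)) // b_le // divr_gt0 ?ltr0n.
apply/ler_addgt0Pr => e e0.
have e'0 : 0 < e / g t by rewrite divr_gt0 ?g_gt0.
have [x0 x00 x0b] := b_inf e'0.
set Z := g s * _.
have cU : (fun i => (b + e / g t) * g ((n i).+1%:R / (phi i)%:R) + Z) @ \oo -->
    (b + e / g t) * g t + Z.
  apply: cvgD; last exact: cvg_cst.
  by apply: cvgM => //; exact: cvg_cst.
have -> : b * g t + Z + e = (b + e / g t) * g t + Z.
  by field; rewrite gt_eqF ?g_gt0.
apply: (ler_cvg_to cS1 cU); near=> i.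
have NR : 0 < (phi i)%:R :> R by rewrite ltr0n.
have /andP[_ up] := tail i; apply: (le_trans up).
have b1 : (g (1%:R / (phi i)%:R))^-1 < b + e / g t.
  apply: x0b; first by rewrite divr_gt0.
  rewrite ler_pdivrMr // -ler_pdivrMl // mulr1.
  by near: i; exact: near_phi.
apply: lerD.
  by rewrite mulrC ler_wpM2r ?(ltW (a_gt0 (phi0 i) _)) // ltW.
(* For large N, n-J+1 <= N(t-s)+2 <= 2N(t-s): this is the origin of the factor 2. *)
have m1 : g ((t - s) *+ 2) <= g ((n i - J i).+1%:R / (phi i)%:R).
  apply: cm_noninc => //; first by rewrite divr_gt0 // ltr0n.
  have /andP[_ d1] := truncn_subr (sN0 i) (stN i).
  rewrite ler_pdivrMr // mulr2n mulrDl.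
  have tsN : 0 <= (t - s) * (phi i)%:R by rewrite mulr_ge0 // ltW.
  have /andP[z1 _] := truncn_itv tsN.
  have h2 : 1 + 1 <= (t - s) * (phi i)%:R.
    by rewrite -ler_pdivrMl //; near: i; exact: near_phi.
  apply: le_trans (_ : (Num.truncn ((t - s) * (phi i)%:R)).+2%:R <= _).
    by rewrite ler_nat ltnS mulrBl.
  by rewrite -!natr1; lra.
apply: ler_pM.
- exact/ltW/(a_gt0 (phi0 i)).
- rewrite subr_ge0 lef_pV2 ?posrE ?(a_gt0 (phi0 i)) //.
  by rewrite (cm_seq_noninc (cma (phi0 i))).
- apply: cm_noninc => //; rewrite ler_pdivlMr //.
  by have /andP[_ /ltW] := truncn_itv (sN0 i).
apply: lerB; last by rewrite b_le // divr_gt0.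
by rewrite lef_pV2 ?posrE ?(a_gt0 (phi0 i)) // g_gt0 // mulrn_wgt0.
Unshelve. all: by end_near. Qed.

End ConvolutionLimit.

(* The library also has a [conv], for convex combinations. *)
Section RegularSonineEquation.
Context {R : realType}.
Local Notation mu := (@lebesgue_measure R).

Lemma exists_reciprocal_cm_seq (g : R -> R) : completely_monotone g ->
  (forall t, 0 < t -> 0 < g t) ->
  exists c : nat -> nat -> R, (forall N, cm_seq (c N)) /\
    forall N, (0 < N)%N -> forall n,
      \sum_(k < n.+1) g ((n - k).+1%:R / N%:R) * c N k = 1.
Proof.
move=> cmg g_gt0.
have H N : exists c : nat -> R, cm_seq c /\ ((0 < N)%N -> forall n,
    \sum_(k < n.+1) g ((n - k).+1%:R / N%:R) * c k = 1).
  (* There is no grid for N = 0; the zero sequence is a default. *)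
  case: (posnP N) => [->|N0].
    exists (fun=> 0); split=> // k n.
    have -> : fdiff k (fun=> 0) n = 0 :> R; last by [].
    by elim: k n => [//|k IHk] n; rewrite fdiffS !IHk subrr.
  have NV : 0 < N%:R^-1 :> R by rewrite invr_gt0 ltr0n.
  have [|c cmc c1] := cm_seq_reciprocal (cm_cm_seq cmg NV).
    by move=> n; rewrite g_gt0 // mulr_gt0 // ltr0n.
  by exists c; split.
have [c Hc] := choice H.
by exists c; split=> N; [have [] := Hc N|move=> N0; have [_] := Hc N; apply].
Qed.

(** Let s increase to t in [conv_tail_bounds]: the remainder vanishes because 1/g(2(t-s)) tends to
    b, and the truncated integrals increase to the convolution. *)
Lemma cm_sonine_exists (g : R -> R) : completely_monotone g ->
  (forall t, 0 < t -> 0 < g t) -> L1loc g ->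
  exists (b : R) (f : R -> R), [/\ forall x, 0 < x -> b <= (g x)^-1,
    forall e, 0 < e -> exists2 x0, 0 < x0 &
      forall x, 0 < x -> x <= x0 -> (g x)^-1 < b + e,
    completely_monotone f & regular_sonine_eq b g f].
Proof.
move=> cmg g_gt0 gL1.
have [c [cmc gc1]] := exists_reciprocal_cm_seq cmg g_gt0.
have [|f [phi [cmf phi_gt phif]]] := cm_seq_subseq_limit cmc.
  move=> t t0; exists (t * g (t + 1))^-1; exists 1%N => // N /= N0.
  exact: (scaled_reciprocal_le cmg g_gt0 cmc gc1).
pose B := [set (g x)^-1 | x in `]0, +oo[%classic].
have hB : has_inf B.
  split; first by exists (g 1)^-1, 1; rewrite //= in_itv /= ltr01.
  exists 0 => y [x /= + <-]; rewrite in_itv /= andbT => x0.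
  by rewrite invr_ge0 ltW ?g_gt0.
pose b := inf B.
have b_le x : 0 < x -> b <= (g x)^-1.
  move=> x0; apply: (ge_inf hB.2); exists x => //=.
  by rewrite in_itv /= x0.
have b_inf e : 0 < e -> exists2 x0, 0 < x0 &
    forall x, 0 < x -> x <= x0 -> (g x)^-1 < b + e.
  move=> e0; have [_ [x0 /= + <-] lte] := inf_adherent e0 hB.
  rewrite in_itv /= andbT => x00; exists x0 => // x xgt0 xx0.
  by apply: le_lt_trans lte; rewrite lef_pV2 ?posrE ?g_gt0 // cm_noninc.
exists b, f; split => // t t0.
(* Then 2(t - s m) = t/(m+1), and s m >= t/2 keeps g(s m) below g(t/2). *)
pose s m : R := t - t / 2 / m.+1%:R.
have t20 : 0 < t / 2 by rewrite divr_gt0.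
have sm1 m : t / 2 <= s m.
  have : t / 2 / m.+1%:R <= t / 2.
    by rewrite ler_pdivrMr // ler_peMr ?(ltW t20) // ler1n.
  by rewrite /s; move: (t / 2 / m.+1%:R) => X; lra.
have sm0 m : 0 < s m by exact: lt_le_trans (sm1 m).
have smt m : s m < t by rewrite ltrBlDr ltrDl divr_gt0.
pose h x := (g x * f (t - x))%:E.
pose F m := `]0%R, s m[%classic.
have ndF : {homo F : n m / (n <= m)%N >-> (n <= m)%O}.
  move=> n m nm; rewrite subsetEset /F; apply: subset_itvl.
  by rewrite bnd_simp lerB // ler_wpM2l ?(ltW t20) // lef_pV2 ?posrE ?ler_nat.
have UF : \bigcup_m F m = `]0, t[%classic.
  apply/seteqP; split=> x /=.
    move=> [m _]; rewrite /F /= !in_itv /= => /andP[-> xs] /=.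
    exact: lt_trans (smt m).
  rewrite in_itv /= => /andP[x0 xt]; exists (Num.truncn (t / 2 / (t - x))) => //.
  rewrite /F /= in_itv /= x0 /= /s ltrBrDr -ltrBrDl.
  rewrite ltr_pdivrMr // [X in _ < X]mulrC.
  by rewrite -ltr_pdivrMr ?subr_gt0 // truncnS_gt.
have mh m : measurable_fun (F m) h.
  have [igf _] := cvg_discrete_conv cmg g_gt0 gL1 cmc gc1 cmf phi_gt
    phif (sm0 m) (smt m).
  exact: measurable_int igf.
have h0 m x : F m x -> (0 <= h x)%E.
  rewrite /F /= in_itv /= => /andP[x0 xs].
  by rewrite lee_fin mulr_ge0 // cm_ge0 // subr_gt0 (lt_trans xs).
have cvI : (fun m => \int[mu]_(x in F m) h x)%E @ \oo -->
    (\int[mu]_(x in `]0%R, t[) h x)%E.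
  rewrite -UF; apply: ge0_nondecreasing_set_cvg_integral => // m.
  exact: measurable_itv.
have bounds m := conv_tail_bounds cmg g_gt0 gL1 cmc gc1 cmf phi_gt phif
  (sm0 m) (smt m) b_le b_inf.
have Ifin m : (\int[mu]_(x in F m) h x)%E \is a fin_num.
  have [igf _] := cvg_discrete_conv cmg g_gt0 gL1 cmc gc1 cmf phi_gt
    phif (sm0 m) (smt m).
  exact: integrable_fin_num igf.
have cvI' : (fun m => \int[mu]_(x in F m) h x)%E @ \oo --> (1 - b * g t)%:E.
  apply: cvg_EFin; first exact: nearW.
  apply/cvgrPdist_le => e e0.
  have gt2 := g_gt0 _ t20; have e'0 : 0 < e / g (t / 2) by rewrite divr_gt0.
  have [x0 x00 x0b] := b_inf _ e'0.
  near=> m; have /andP[lo up] := bounds m.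
  have small : (g ((t - s m) *+ 2))^-1 < b + e / g (t / 2).
    have -> : (t - s m) *+ 2 = t / m.+1%:R by rewrite /s; field.
    apply: x0b; first by rewrite divr_gt0.
    rewrite ler_pdivrMr // -ler_pdivrMl //.
    apply: le_trans (_ : m%:R <= _); last by rewrite ler_nat.
    by near: m; exact: nbhs_infty_ger.
  have b_le' : b <= (g ((t - s m) *+ 2))^-1.
    by apply: b_le; rewrite mulrn_wgt0 // subr_gt0.
  have up' : g (s m) * ((g ((t - s m) *+ 2))^-1 - b) <= e.
    apply: le_trans (_ : g (t / 2) * (e / g (t / 2)) <= _).
      apply: ler_pM; rewrite ?subr_ge0 ?(ltW (g_gt0 _ _)) //.
        exact: cm_noninc.
      by lra.
    by rewrite mulrC divfK // gt_eqF.
  rewrite /= /h -/(F m) ler_norml; apply/andP; split; lra.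
have -> : Defs.conv g f t = (1 - b * g t)%:E.
  exact: (cvg_unique _ cvI cvI').
by rewrite -EFinD addrC subrK.
Unshelve. all: by end_near. Qed.

End RegularSonineEquation.

(** * Uniqueness *)

Section Reflection.
Context {R : realType}.
Local Notation mu := (@lebesgue_measure R).

Lemma measurable_reflect (t : R) :
  measurable_fun [set: R] (fun x : R => t - x : measurableTypeR R).
Proof. by apply: measurable_funB; [exact: measurable_cst|exact: measurable_id]. Qed.

(** By uniqueness of Lebesgue measure, half-open intervals suffice, and reflection preserves their
    length. *)
Lemma lebesgue_measure_reflect (t : R) (A : set R) : measurable A ->
  pushforward mu (fun x : R => t - x : measurableTypeR R) A = mu A.
Proof.
have mr := measurable_reflect t.
pose mixin := isMeasurableFun.Build _ _ _ _ _ mr.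
pose pk : {mfun R >-> measurableTypeR R} :=
  HB.pack (fun x : R => t - x : measurableTypeR R) mixin.
move=> mA; apply/esym.
apply: (@lebesgue_measure_unique _ (pushforward mu pk)) => //= _ [[a b]] _ <-.
rewrite /pushforward /=.
have -> : (fun x => t - x) @^-1` `]a, b] = `[t - b, t - a[%classic.
  apply/seteqP; split => x /=; rewrite !in_itv /= => /andP[h1 h2];
    by apply/andP; split; lra.
rewrite !lebesgue_measure_itv /= !lte_fin ltrD2l ltrN2.
by case: ifP => // _; rewrite -!EFinB; congr EFin; ring.
Qed.

Lemma ge0_integral_reflect (t : R) (h : R -> \bar R) :
  measurable_fun [set: R] h -> (forall x, 0 <= h x)%E ->
  (\int[mu]_x h (t - x)%R = \int[mu]_x h x)%E.
Proof.
move=> mh h0.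
transitivity
  (\int[pushforward mu (fun x : R => (t - x)%R : measurableTypeR R)]_x h x)%E.
  by rewrite ge0_integral_pushforward //; exact: measurable_reflect.
apply: eq_measure_integral => [|mr A mA _]; first exact: measurable_reflect.
exact: lebesgue_measure_reflect.
Qed.

Lemma integral_reflect (t : R) (h : R -> \bar R) : measurable_fun [set: R] h ->
  (\int[mu]_x h (t - x)%R = \int[mu]_x h x)%E.
Proof.
move=> mh; rewrite integralE [RHS]integralE.
congr (_ - _)%E.
  have p0 x : (0 <= h^\+ x)%E by [].
  rewrite -(ge0_integral_reflect t (measurable_funepos mh) p0).
  apply: eq_integral => x _.
  exact: (congr1 (fun k => k x) (funepos_comp h (fun x : R => t - x))).
have n0 x : (0 <= h^\- x)%E by [].
rewrite -(ge0_integral_reflect t (measurable_funeneg mh) n0).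
apply: eq_integral => x _.
exact: (congr1 (fun k => k x) (funeneg_comp h (fun x : R => t - x))).
Qed.

(** A difference of extended reals is finite only if both terms are; hence a convolution equation
    with finite values already contains absolute convergence. *)
Lemma fin_num_integrable (h : R -> \bar R) : measurable_fun [set: R] h ->
  (\int[mu]_x h x \is a fin_num)%E -> mu.-integrable [set: R] h.
Proof.
move=> mh; rewrite integralE fin_numB => /andP[hp hn].
apply/integrableP; split => //.
have -> : (fun x => `|h x|)%E = (h^\+ \+ h^\-)%E by rewrite -fune_abse.
rewrite ge0_integralD //; [|exact: measurable_funepos|exact: measurable_funeneg].
by rewrite lte_add_pinfty // ltey_eq ?hp ?hn.
Qed.

End Reflection.

(** * The double convolution integral *)

Section ConvolutionFubini.
Context {R : realType}.
Local Notation mu := (@lebesgue_measure R).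
Variables F1 F K q : R -> R.
Hypotheses (mF1 : measurable_fun [set: R] F1) (mF : measurable_fun [set: R] F).
Hypothesis mq : measurable_fun [set: R] q.
Hypothesis mK : measurable_fun [set: R] K.
Hypotheses (F_ge0 : forall x, 0 <= F x) (K_ge0 : forall x, 0 <= K x).
Hypothesis cF1 : forall w, (\int[mu]_x (F1 x * K (w - x))%:E = (q w)%:E)%E.
Hypothesis cF : forall w, (\int[mu]_x (F x * K (w - x))%:E = (q w)%:E)%E.
Hypotheses (q_le1 : forall w, q w <= 1) (q_le0 : forall w, w <= 0 -> q w = 0).

Let mconv (G : R -> R) (w : R) : measurable_fun [set: R] G ->
  measurable_fun [set: R] (fun x => (G x * K (w - x))%:E).
Proof.
move=> mG; apply/measurable_EFinP/measurable_funM => //.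
by apply: measurableT_comp => //; exact: measurable_reflect.
Qed.

Let iF1 w : mu.-integrable [set: R] (fun x => (F1 x * K (w - x))%:E).
Proof. by apply: fin_num_integrable; [exact: mconv|rewrite cF1]. Qed.

Let iF w : mu.-integrable [set: R] (fun x => (F x * K (w - x))%:E).
Proof. by apply: fin_num_integrable; [exact: mconv|rewrite cF]. Qed.

Let q_ge0 w : 0 <= q w.
Proof.
by rewrite -lee_fin -cF integral_ge0 // => x _; rewrite lee_fin mulr_ge0.
Qed.

(** Both sides are iterated integrals of F1(u) F(v) K(t-u-v): integrating first in v leaves F1(u)
    q(t-u), first in u leaves F(v) q(t-v). *)
Lemma conv_fubini (t : R) : mu.-integrable `]-oo, t] (EFin \o F1) ->
  (\int[mu]_x (F1 x * q (t - x))%:E = \int[mu]_x (F x * q (t - x))%:E)%E.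
Proof.
move=> iF1t.
pose H (z : R * R) : \bar R := (F1 z.1 * (F z.2 * K (t - z.1 - z.2)))%:E.
have mH : measurable_fun [set: R * R] H.
  apply/measurable_EFinP/measurable_funM.
    by apply: measurableT_comp => //; exact: measurable_fst.
  apply: measurable_funM.
    by apply: measurableT_comp => //; exact: measurable_snd.
  apply: (measurableT_comp mK); apply: measurable_funB; last exact: measurable_snd.
  apply: measurable_funB; first exact: measurable_cst.
  exact: measurable_fst.
have E1 u : (\int[mu]_v H (u, v) = (F1 u * q (t - u))%:E)%E.
  rewrite /H /=; under eq_integral do rewrite EFinM.
  by rewrite integralZl // cF.
have E2 v : (\int[mu]_u H (u, v) = (F v * q (t - v))%:E)%E.
  rewrite EFinM -cF1 -integralZl //; apply: eq_integral => u _.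
  rewrite /H /= -EFinM; congr EFin; have -> : t - u - v = t - v - u by ring.
  by ring.
transitivity (\int[mu]_u \int[mu]_v H (u, v))%E.
  by apply: eq_integral => u _; rewrite E1.
transitivity (\int[mu]_v \int[mu]_u H (u, v))%E; last first.
  by apply: eq_integral => u _; rewrite E2.
apply: Fubini; apply/integrable12ltyP => //.
(* Only [F1] may change sign, so the absolute value falls on it alone. Since q <= 1, and q(t-u) = 0
   for u >= t, integrability of [F1] up to t suffices. *)
have A1 u : (\int[mu]_v `|H (u, v)| = (`|F1 u| * q (t - u))%:E)%E.
  rewrite EFinM -cF -integralZl //; apply: eq_integral => v _.
  by rewrite /H /= -EFinM normrM (ger0_norm (mulr_ge0 _ _)).
under eq_integral do rewrite A1.
move/integrableP : iF1t => [_]; apply: le_lt_trans.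
have mF1a : measurable_fun [set: R] (fun x => `|(EFin \o F1) x|%E).
  by apply: measurableT_comp => //; apply/measurable_EFinP.
rewrite [leRHS]integral_mkcond; apply: ge0_le_integral => //.
- by move=> x _; rewrite lee_fin mulr_ge0.
- apply/measurable_EFinP/measurable_funM; first exact: measurableT_comp.
  by apply: measurableT_comp => //; exact: measurable_reflect.
- apply/(measurable_restrictT _ (measurable_itv _)).
  exact: measurable_funTS mF1a.
move=> x _; rewrite patchE; case: ifPn => [_|].
  by rewrite lee_fin ler_piMr.
rewrite notin_setE /= in_itv /= => /negP; rewrite -ltNge => tx.
by rewrite q_le0 ?mulr0 // subr_le0 ltW.
Qed.

End ConvolutionFubini.

(** * Extension by zero, and functions with equal primitives *)

Section ZeroExtension.
Context {R : realType}.
Local Notation mu := (@lebesgue_measure R).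
Implicit Types f g : R -> R.

(** It turns a convolution over ]0, t[ into an integral over the whole line with a domain free of t,
    as reflection and Fubini require. *)
Definition zext f : R -> R := f \_ `]0, +oo[%classic.

Lemma zext_pos f x : 0 < x -> zext f x = f x.
Proof. by move=> x0; rewrite /zext patchE mem_set //= in_itv /= x0. Qed.

Lemma zext_neg f x : x <= 0 -> zext f x = 0.
Proof.
move=> x0; rewrite /zext patchE memNset //= in_itv /= andbT.
by apply/negP; rewrite -leNgt.
Qed.

Lemma conv_zext f g t :
  Defs.conv f g t = (\int[mu]_s (zext f s * zext g (t - s))%:E)%E.
Proof.
rewrite /Defs.conv integral_mkcond; apply: eq_integral => s _; rewrite patchE.
case: ifPn => [|].
  by rewrite inE /= in_itv /= => /andP[s0 st]; rewrite !zext_pos // subr_gt0.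
rewrite notin_setE /= in_itv /= => /negP; rewrite negb_and -!leNgt => /orP[h|h].
  by rewrite zext_neg // mul0r.
by rewrite (@zext_neg g) ?mulr0 // subr_le0.
Qed.

Lemma measurable_zext_cm f : completely_monotone f ->
  measurable_fun [set: R] (zext f).
Proof.
move=> cmf; apply/(measurable_restrictT _ (measurable_itv _)).
apply: open_continuous_measurable_fun => // x.
by rewrite inE /= in_itv /= andbT => x0; exact: cm_continuous.
Qed.

Lemma measurable_zext f : L1loc f -> measurable_fun [set: R] (zext f).
Proof.
move=> fL; apply/(measurable_restrictT _ (measurable_itv _)).
have -> : `]0, +oo[%classic = \bigcup_n `]0%R, n.+1%:R]%classic :> set R.
  apply/seteqP; split=> x /=.
    rewrite in_itv /= andbT => x0; exists (Num.truncn x) => //=.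
    by rewrite in_itv /= x0 ltW // truncnS_gt.
  by move=> [n _ /=]; rewrite !in_itv /= andbT => /andP[].
apply/measurable_fun_bigcup => [n|n]; first exact: measurable_itv.
apply/measurable_EFinP; exact: measurable_int (fL n.+1%:R (ltr0Sn _ _)).
Qed.

Lemma convC f g t : measurable_fun [set: R] (zext f) ->
  measurable_fun [set: R] (zext g) -> Defs.conv f g t = Defs.conv g f t.
Proof.
move=> mf mg; rewrite !conv_zext.
rewrite -(integral_reflect t); last first.
  apply/measurable_EFinP/measurable_funM => //.
  by apply: measurableT_comp => //; exact: measurable_reflect.
by apply: eq_integral => s _; rewrite subKr mulrC.
Qed.

Lemma integrable_zext f b : L1loc f -> mu.-integrable `]-oo, b] (EFin \o zext f).
Proof.
move=> fL; pose c := Num.max b 1.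
have c0 : 0 < c by rewrite lt_max ltr01 orbT.
have ic : mu.-integrable `]-oo, c] (EFin \o zext f).
  have := fL c c0; rewrite integrable_mkcond //= => H.
  rewrite integrable_mkcond //=; move: H; congr (integrable _ _ _).
  apply/funext => x.
  rewrite !patchE !mem_setE !in_itv /=; case: (ltP 0 x) => x0 /=.
    by rewrite zext_pos.
  by rewrite zext_neg // if_same.
apply: integrableS ic; [exact: measurable_itv|exact: measurable_itv|].
by apply: subset_itvl; rewrite bnd_simp le_max lexx.
Qed.

Lemma integral_zext f x : (\int[mu]_(s in `]-oo, x]) (zext f s)%:E =
  \int[mu]_(s in `]0%R, x]) (f s)%:E)%E.
Proof.
rewrite integral_mkcond [RHS]integral_mkcond; apply: eq_integral => s _.
rewrite !patchE !mem_setE !in_itv /=; case: (ltP 0 s) => s0 /=.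
  by rewrite zext_pos.
by rewrite zext_neg // if_same.
Qed.

Lemma locally_integrable_zext f : L1loc f -> locally_integrable [set: R] (zext f).
Proof.
move=> fL; split; [exact: measurable_zext|exact: openT|move=> K _ cK].
have [M [Mr HM]] := compact_bounded cK.
have KM : K `<=` `]-oo, (M + 1)].
  move=> x Kx /=; rewrite in_itv /=.
  by apply: le_trans (ler_norm _) _; apply: (HM (M + 1)); rewrite ?ltrDl.
have /integrableP[mz] := integrable_zext (M + 1) fL; apply: le_lt_trans.
apply: ge0_subset_integral => //; first exact: compact_measurable.
apply/measurable_EFinP/measurableT_comp => //.
by apply: measurable_funTS; exact: measurable_zext.
Qed.

(** Lebesgue differentiation: without continuity the equality can only hold almost everywhere. *)
Lemma integral_zext_ae f1 f2 : L1loc f1 -> L1loc f2 ->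
  (forall t, 0 < t -> (\int[mu]_(s in `]0%R, t]) (f1 s)%:E =
    \int[mu]_(s in `]0%R, t]) (f2 s)%:E)%E) ->
  {ae mu, forall t, 0 < t -> f1 t = f2 t}.
Proof.
move=> L1 L2 E.
have FE : (fun x : R => \int[mu]_(t in [set` `]-oo, x]]) (zext f1 t))%R =
    (fun x : R => \int[mu]_(t in [set` `]-oo, x]]) (zext f2 t))%R.
  apply/funext => x; rewrite /Rintegral !integral_zext.
  have [x0|x0] := ltP 0 x; first by rewrite E.
  by rewrite set_itv_ge ?bnd_simp -?leNgt // !integral_set0.
have H1 := FTC1Ny (fun y => integrable_zext y L1) (locally_integrable_zext L1).
have H2 := FTC1Ny (fun y => integrable_zext y L2) (locally_integrable_zext L2).
apply: filterS2 H1 H2; first exact: (ae_filter_ringOfSetsType mu).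
move=> x [_ D1] [_ D2] x0.
by rewrite -(zext_pos f1 x0) -D1 -(zext_pos f2 x0) -D2 FE.
Qed.

(** For continuous integrands the fundamental theorem of calculus applies at every point. *)
Lemma integral_zext_cm f1 f2 : licm f1 -> licm f2 ->
  (forall t, 0 < t -> (\int[mu]_(s in `]0%R, t]) (f1 s)%:E =
    \int[mu]_(s in `]0%R, t]) (f2 s)%:E)%E) ->
  forall t, 0 < t -> f1 t = f2 t.
Proof.
move=> [cm1 L1] [cm2 L2] E x x0.
have FE : (fun x : R => \int[mu]_(t in [set` `]-oo, x]]) (zext f1 t))%R =
    (fun x : R => \int[mu]_(t in [set` `]-oo, x]]) (zext f2 t))%R.
  apply/funext => y; rewrite /Rintegral !integral_zext.
  have [y0|y0] := ltP 0 y; first by rewrite E.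
  by rewrite set_itv_ge ?bnd_simp -?leNgt // !integral_set0.
have cz f : completely_monotone f -> {for x, continuous (zext f)}.
  move=> cmf; rewrite /prop_for /continuous_at zext_pos //.
  apply: cvg_trans (cm_continuous cmf x0); apply: near_eq_cvg.
  by near=> y; rewrite zext_pos //; near: y; exact: lt_nbhsr.
have xx1 : x < x + 1 by rewrite ltrDl.
have D f : licm f ->
    derive1 (fun x : R => \int[mu]_(t in [set` `]-oo, x]]) (zext f t))%R x = f x.
  move=> [cmf Lf].
  have [|_ ->] := continuous_FTC1 xx1 (integrable_zext (x + 1) Lf) _ (cz f cmf).
    by rewrite ltNyr.
  exact: zext_pos.
by rewrite -(D f1) // -(D f2) // FE.
Unshelve. all: by end_near. Qed.

End ZeroExtension.

(** * Uniqueness, local integrability of the solution, and behaviour at 0 *)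

Section SonineUniqueness.
Context {R : realType}.
Local Notation mu := (@lebesgue_measure R).
Implicit Types f g : R -> R.

Lemma zext_ge0 f x : completely_monotone f -> 0 <= zext f x.
Proof.
move=> cmf; have [x0|x0] := ltP 0 x; last by rewrite zext_neg.
by rewrite zext_pos // cm_ge0.
Qed.

Lemma regular_sonine_eq_conv (a : R) g f t : regular_sonine_eq a g f -> 0 < t ->
  Defs.conv g f t = (1 - a * g t)%:E.
Proof.
move=> E t0; have := E t t0; case: (Defs.conv g f t) => [r| |] //.
by rewrite -EFinD => -[h]; congr EFin; lra.
Qed.

(** With q = 1 - a g on the positive axis, [conv_fubini] gives f1 * q = f2 * q. Each side is the
    primitive of its function minus a q, because g * f = q, and the terms a q cancel. *)
Lemma regular_sonine_integral (a : R) g f1 f2 : 0 <= a ->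
  licm g -> L1loc f1 -> licm f2 ->
  regular_sonine_eq a g f1 -> regular_sonine_eq a g f2 ->
  forall t, 0 < t -> (\int[mu]_(s in `]0%R, t]) (f1 s)%:E =
    \int[mu]_(s in `]0%R, t]) (f2 s)%:E)%E.
Proof.
move=> a0 [cmg gL] L1 [cm2 L2] E1 E2 t t0.
have mg := measurable_zext gL.
have m1 := measurable_zext L1; have m2 := measurable_zext L2.
pose q := zext (fun w => 1 - a * g w).
have qE w : q w = \1_(`]0%R, +oo[%classic) w - a * zext g w.
  rewrite /q indicE mem_setE in_itv /= andbT; case: ltP => w0.
    by rewrite !zext_pos.
  by rewrite !zext_neg // mulr0 subr0.
have cq f : measurable_fun [set: R] (zext f) -> regular_sonine_eq a g f -> forall w,
    (\int[mu]_x (zext f x * zext g (w - x))%:E = (q w)%:E)%E.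
  move=> mf E w; rewrite -conv_zext; have [w0|w0] := ltP 0 w.
    by rewrite convC // (regular_sonine_eq_conv E) // /q zext_pos.
  rewrite /q zext_neg // conv_zext integral0_eq // => x _.
  have [x0|x0] := ltP 0 x; last by rewrite zext_neg // mul0r.
  by rewrite (@zext_neg _ g) ?mulr0 // subr_le0 (le_trans w0) // ltW.
have mq : measurable_fun [set: R] q.
  have -> : q = (fun w => \1_(`]0%R, +oo[%classic) w - a * zext g w).
    by apply/funext => w; exact: qE.
  apply: measurable_funB; first by apply: measurable_indic; exact: measurable_itv.
  by apply: measurable_funM => //; exact: measurable_cst.
have q_le1 w : q w <= 1.
  have [w0|w0] := ltP 0 w; last by rewrite /q zext_neg // ler01.
  by rewrite /q zext_pos // gerBl mulr_ge0 // cm_ge0.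
have q_le0 w : w <= 0 -> q w = 0 by move=> w0; rewrite /q zext_neg.
have key := conv_fubini m1 m2 mq mg (fun x => zext_ge0 x cm2)
  (fun x => zext_ge0 x cmg) (cq _ m1 E1) (cq _ m2 E2) q_le1 q_le0
  (integrable_zext t L1).
have split f : L1loc f -> regular_sonine_eq a g f ->
    (\int[mu]_x (zext f x * q (t - x))%:E =
     \int[mu]_(s in `]0%R, t]) (f s)%:E - (a * q t)%:E)%E.
  move=> fL E; have mf := measurable_zext fL.
  have mfg : measurable_fun [set: R] (fun x => (zext f x * zext g (t - x))%:E).
    apply/measurable_EFinP/measurable_funM => //.
    by apply: measurableT_comp => //; exact: measurable_reflect.
  have ifg : mu.-integrable [set: R] (fun x => (zext f x * zext g (t - x))%:E).
    by apply: fin_num_integrable; rewrite ?cq.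
  have if1 : mu.-integrable [set: R] ((EFin \o zext f) \_ `]-oo, t[).
    have := integrable_zext t fL => H.
    rewrite -integrable_mkcond //=; apply: integrableS H => //.
    by apply: subset_itvl; rewrite bnd_simp.
  rewrite -integral_zext -integral_itv_bndo_bndc; last first.
    by apply/measurable_EFinP; exact: measurable_funTS.
  rewrite [X in (_ = X - _)%E]integral_mkcond EFinM -(cq f mf E t).
  rewrite -integralZl // -integralB //; last exact: integrableZl.
  apply: eq_integral => x _; rewrite patchE mem_setE in_itv /= qE indicE mem_setE.
  rewrite in_itv /= andbT subr_gt0; case: ifP => _ /=.
    by rewrite -?EFinM -EFinB; congr EFin; ring.
  by rewrite -[point]/(0%E) add0e; congr EFin; ring.
move: key; rewrite (split f1) // (split f2) //.
move=> /(congr1 (fun z => z + (a * q t)%:E)%E).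
by rewrite !subeK.
Qed.

Lemma measurable_pos f : measurable_fun [set: R] (zext f) ->
  measurable_fun (`]0, +oo[ : set R) f.
Proof. by move=> mf; apply/(measurable_restrictT _ (measurable_itv _)). Qed.

Lemma measurable_conv_integrand f g (t : R) : measurable_fun [set: R] (zext f) ->
  completely_monotone g -> measurable_fun `]0, t[ (fun s => (f s * g (t - s))%:E).
Proof.
move=> mf cmg; apply/measurable_EFinP/measurable_funM.
  apply: measurable_funS (measurable_pos mf); first exact: measurable_itv.
  by apply: subset_itvl; rewrite bnd_simp.
apply: open_continuous_measurable_fun => // x.
rewrite inE /= in_itv /= => /andP[_ xt].
apply: (@continuous_comp _ _ _ (fun x => t - x) g); last first.
  by apply: cm_continuous; rewrite ?subr_gt0.
by apply: cvgB; [exact: cvg_cst|exact: cvg_id].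
Qed.

(** For t = b+1, monotonicity of [g] bounds g(t) times the integral of [f] over ]0, b] by the
    convolution at t, which is 1 - a g(t) <= 1. *)
Lemma regular_sonine_L1loc (a : R) g f : 0 <= a -> licm g ->
  (forall t, 0 < t -> 0 < g t) -> completely_monotone f ->
  regular_sonine_eq a g f -> L1loc f.
Proof.
move=> a0 [cmg gL] g_gt0 cmf E b b0.
pose t := b + 1; have t0 : 0 < t by rewrite addr_gt0.
have mf := measurable_zext_cm cmf; have mg := measurable_zext gL.
have mfb : measurable_fun `]0, b] f.
  apply: measurable_funS (measurable_pos mf); first exact: measurable_itv.
  by apply: subset_itvl; rewrite bnd_simp.
apply/integrableP; split; first exact/measurable_EFinP.
have mafb : measurable_fun `]0, b] (fun x => `|(EFin \o f) x|%E).
  by apply/measurable_EFinP; exact: measurableT_comp.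
have c1 : (Defs.conv f g t <= 1)%E.
  rewrite convC // (regular_sonine_eq_conv E) // lee_fin gerBl.
  by rewrite mulr_ge0 // cm_ge0.
have bt : `]0, b] `<=` (`]0, t[ : set R).
  by apply: subset_itvl; rewrite bnd_simp ltrDl.
have mh := measurable_conv_integrand (t := t) mf cmg.
have h0 x : `]0, t[%classic x -> (0 <= (f x * g (t - x))%:E)%E.
  rewrite /= in_itv /= => /andP[x0 xt].
  by rewrite lee_fin mulr_ge0 ?cm_ge0 // subr_gt0.
have gt_le : ((g t)%:E * \int[mu]_(x in `]0%R, b]) `|(EFin \o f) x| <= 1)%E.
  apply: le_trans c1.
  apply: le_trans
    (_ : (\int[mu]_(x in `]0%R, b]) (f x * g (t - x))%:E <= _)%E); last first.
    by apply: ge0_subset_integral => //; exact: measurable_itv.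
  rewrite -ge0_integralZl_EFin //; last exact/ltW/g_gt0.
  apply: ge0_le_integral => //.
  - by move=> x _; rewrite mule_ge0 // lee_fin ltW ?g_gt0.
  - exact: measurable_funeM.
  - by apply: measurable_funS mh => //; exact: measurable_itv.
  move=> x /=; rewrite in_itv /= => /andP[x0 xb].
  have xt : x < t by rewrite (le_lt_trans xb) // ltrDl.
  rewrite lee_fin (ger0_norm (cm_ge0 cmf x0)) mulrC ler_wpM2l ?cm_ge0 //.
  by rewrite cm_noninc ?subr_gt0 // gerBl ltW.
have gt0 := g_gt0 t t0.
by rewrite ltey; apply/eqP => Einf; move: gt_le; rewrite Einf gt0_muley ?lte_fin //.
Qed.

Lemma L1loc_small f (e : R) : L1loc f -> (forall x, 0 < x -> 0 <= f x) -> 0 < e ->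
  exists2 d, 0 < d & forall t, 0 < t -> t < d ->
    (\int[mu]_(x in `]0%R, t[) (f x)%:E < e%:E)%E.
Proof.
move=> fL f0 e0.
have i01 : mu.-integrable `[0, 1] (EFin \o zext f).
  apply: integrableS (integrable_zext 1 fL);
    [exact: measurable_itv|exact: measurable_itv|].
  by move=> x /=; rewrite !in_itv /= => /andP[].
have := parameterized_integral_near_left ltr01 e0 i01.
move=> /nbhs_ballP[d /= d0 Hd]; exists d => // t t0 td.
have := Hd t; rewrite /ball /= sub0r normrN gtr0_norm // => /(_ td (ltW t0)).
rewrite /parameterized_integral /Rintegral => H.
have it : mu.-integrable `[0, t] (EFin \o zext f).
  apply: integrableS (integrable_zext t fL);
    [exact: measurable_itv|exact: measurable_itv|].
  by move=> x /=; rewrite !in_itv /= => /andP[].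
have -> : (\int[mu]_(x in `]0%R, t[) (f x)%:E =
    \int[mu]_(x in `[0%R, t]) (zext f x)%:E)%E.
  rewrite -integral_itv_obnd_cbnd; last first.
    apply/measurable_EFinP; apply: measurable_funTS; exact: measurable_zext.
  rewrite -integral_itv_bndo_bndc; last first.
    apply/measurable_EFinP; apply: measurable_funTS; exact: measurable_zext.
  apply: eq_integral => x; rewrite inE /= in_itv /= => /andP[x0 _].
  by rewrite zext_pos.
rewrite -[X in (X < _)%E]fineK ?lte_fin; last exact: integrable_fin_num it.
exact: le_lt_trans (ler_norm _) H.
Qed.

(** A bounded factor makes the convolution vanish at 0. This shows that the associated function is
    singular, and it determines the coefficient a. *)
Lemma conv_small f g (C e : R) : licm f -> completely_monotone g -> 0 < C ->
  (forall x, 0 < x -> g x <= C) -> 0 < e ->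
  exists2 d, 0 < d & forall t, 0 < t -> t < d -> (Defs.conv f g t < e%:E)%E.
Proof.
move=> [cmf fL] cmg C0 gC e0; have eC : 0 < e / C by rewrite divr_gt0.
have [d d0 Hd] := L1loc_small fL (fun x => @cm_ge0 _ f x cmf) eC.
exists d => // t t0 td; have Ht := Hd t t0 td.
have mft : measurable_fun `]0, t[ (EFin \o f).
  apply/measurable_EFinP.
  apply: measurable_funS (measurable_pos (measurable_zext fL)).
    exact: measurable_itv.
  by apply: subset_itvl; rewrite bnd_simp.
have mh := measurable_conv_integrand (t := t) (measurable_zext fL) cmg.
apply: le_lt_trans
  (_ : (C%:E * \int[mu]_(x in `]0%R, t[) (f x)%:E < _)%E); last first.
  by rewrite muleC -lte_pdivlMr //.
rewrite -ge0_integralZl_EFin //; [| |exact: ltW]; last first.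
  by move=> x /=; rewrite in_itv /= => /andP[x0 _]; rewrite lee_fin cm_ge0.
rewrite /Defs.conv; apply: ge0_le_integral => //.
- move=> x /=; rewrite in_itv /= => /andP[x0 xt].
  by rewrite lee_fin mulr_ge0 ?cm_ge0 // subr_gt0.
- by apply: measurable_funeM.
move=> x /=; rewrite in_itv /= => /andP[x0 xt].
by rewrite lee_fin mulrC ler_wpM2r ?cm_ge0 // gC // subr_gt0.
Qed.

(** By monotonicity a bound near 0 is a global bound. *)
Lemma cm_bounded_nearP g : completely_monotone g ->
  bounded_near g (0 : R)^'+ <-> exists2 C, 0 < C & forall x, 0 < x -> g x <= C.
Proof.
move=> cmg; split=> [[M [_ HM]]|[C C0 HC]].
  have M1 : M < `|M| + 1 by rewrite (le_lt_trans (ler_norm _)) // ltrDl.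
  have gM := HM _ M1; exists (`|M| + 1) => [|x x0]; first by rewrite ltr_wpDl.
  near (0 : R)^'+ => y.
  have y0 : 0 < y by near: y; exact: nbhs_right_gt.
  have yx : y <= x by near: y; exact: nbhs_right_le.
  apply: le_trans (cm_noninc cmg y0 yx) (le_trans (ler_norm _) _).
  by near: y.
exists C; split=> [|M CM]; first exact: gtr0_real.
near=> x; have x0 : 0 < x by near: x; exact: nbhs_right_gt.
by rewrite /= ger0_norm ?cm_ge0 // (le_trans (HC x x0)) // ltW.
Unshelve. all: by end_near. Qed.

End SonineUniqueness.

(** * The singular case and the regular case *)

Unset Implicit Arguments.
Set Strict Implicit.

(** The zero function is LICM and regular but solves no such equation, hence the nonzero value
    required in the second half. A merely locally integrable associate is determined almost
    everywhere, a completely monotone one at every point. *)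
Theorem theorem4p1 (R : realType) :
  (forall g : R -> R, slicm g ->
     sonine g /\
     exists f : R -> R,
       [/\ slicm f, sonine_associated g f &
           forall f' : R -> R, sonine_associated g f' ->
             {ae @lebesgue_measure R, forall t : R, 0 < t -> f' t = f t}])
  /\
  (forall g : R -> R, licm g -> regular_at0 g ->
     (exists t : R, 0 < t /\ g t <> 0) ->
     exists (a : R) (phi : R -> R),
       [/\ 0 < a, licm phi, regular_sonine_eq a g phi &
           forall (a' : R) (phi' : R -> R),
             0 < a' -> licm phi' -> regular_sonine_eq a' g phi' ->
             a' = a /\ (forall t : R, 0 < t -> phi' t = phi t)]).
Proof.
split=> [g [[cmg gL] gsing]|g [cmg gL] greg [t1 [t10 gt1]]].
- have unbounded C : 0 < C -> ~ forall x, 0 < x -> g x <= C.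
    by move=> C0 HC; apply/gsing/cm_bounded_nearP => //; exists C.
  have [t1 t10 gt1] : exists2 t1, 0 < t1 & g t1 != 0.
    apply: contrapT => H; apply: (unbounded 1) => // x x0.
    case: (eqVneq (g x) 0) => [->|gx]; first exact: ler01.
    by case: H; exists x.
  have g_gt0 := cm_gt0 cmg t10 gt1.
  have [b [f [b_le b_inf cmf E]]] := cm_sonine_exists cmg g_gt0 gL.
  have b0 : b = 0.
    apply/eqP; rewrite eq_le; apply/andP; split.
      rewrite leNgt; apply/negP => b0; apply: (unbounded b^-1).
        by rewrite invr_gt0.
      by move=> x x0; rewrite -[g x]invrK lef_pV2 ?posrE ?invr_gt0 ?g_gt0 ?b_le.
    apply/ler_addgt0Pr => e e0; have [x0 x00 /(_ x0 x00 (lexx _)) H] := b_inf e e0.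
    by apply: ltW; apply: lt_trans H; rewrite invr_gt0 g_gt0.
  rewrite {b_le b_inf}b0 in E.
  have fL := regular_sonine_L1loc (lexx 0) (conj cmg gL) g_gt0 cmf E.
  have sonine_regular f' : sonine_eq g f' <-> regular_sonine_eq 0 g f'.
    by split=> H t t0; have := H t t0; rewrite mul0r add0e.
  have Ef : sonine_associated g f by split => //; apply/sonine_regular.
  (* If [f] were bounded, g * f would drop below 1 near 0. *)
  have fsing : singular_at0 f.
    move/(cm_bounded_nearP cmf) => [C C0 HC].
    have [d d0 Hd] := conv_small (conj cmg gL) cmf C0 HC ltr01.
    have d20 : 0 < d / 2 by rewrite divr_gt0.
    have := Hd (d / 2) d20 ltac:(lra).
    by rewrite (Ef.2 _ d20) ltxx.
  split; first by split=> //; exists f.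
  exists f; split => // f' [f'L /sonine_regular Ef'].
  apply: integral_zext_ae => //.
  exact: (regular_sonine_integral (lexx 0) (conj cmg gL) f'L (conj cmf fL) Ef' E).
- have [C C0 HC] := (cm_bounded_nearP cmg).1 (contrapT greg).
  have g_gt0 : forall t, 0 < t -> 0 < g t by apply: (cm_gt0 cmg t10); apply/eqP.
  have [a [f [a_le a_inf cmf E]]] := cm_sonine_exists cmg g_gt0 gL.
  (* A bound C of [g] gives 1/g >= 1/C, so the infimum a is at least 1/C. *)
  have a0 : 0 < a.
    apply: lt_le_trans (_ : C^-1 <= _); first by rewrite invr_gt0.
    apply/ler_addgt0Pr => e e0; have [x0 x00 /(_ x0 x00 (lexx _)) H] := a_inf e e0.
    by apply: le_trans (ltW H); rewrite lef_pV2 ?posrE ?g_gt0 ?HC.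
  have fL := regular_sonine_L1loc (ltW a0) (conj cmg gL) g_gt0 cmf E.
  exists a, f; split => // a' f' a'0 [cmf' f'L] E'.
  (* The convolution vanishes at 0, so b g(t) tends to 1: the coefficient must be 1/g(0+). *)
  have near1 b h : completely_monotone h -> L1loc h -> regular_sonine_eq b g h ->
      0 < b -> forall e, 0 < e -> exists2 d, 0 < d & forall t, 0 < t -> t < d ->
      1 - e < b * g t <= 1.
    move=> cmh hL Eh b0 e e0.
    have [d d0 Hd] := conv_small (conj cmh hL) cmg C0 HC e0.
    exists d => // t t0 td; have := Hd t t0 td.
    have c0 : (0 <= Defs.conv h g t)%E.
      apply: integral_ge0 => x /=; rewrite in_itv /= => /andP[x0 xt].
      by rewrite lee_fin mulr_ge0 ?cm_ge0 // subr_gt0.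
    move: c0; rewrite convC; [|exact: measurable_zext|exact: measurable_zext].
    rewrite (regular_sonine_eq_conv Eh) // lee_fin lte_fin => c0 c1.
    by apply/andP; split; lra.
  have le_coef b b' h h' : licm h -> licm h' -> 0 < b -> 0 < b' ->
      regular_sonine_eq b g h -> regular_sonine_eq b' g h' -> b <= b'.
    move=> [cmh hL] [cmh' h'L] b0 b'0 Eh Eh'; rewrite leNgt; apply/negP => lt.
    (* For t <= 1 the values b g(t) and b' g(t) differ by at least this amount, yet near 0 the first
       is at most 1 and the second exceeds 1 minus this amount. *)
    have e0 : 0 < (b - b') * g 1 by rewrite mulr_gt0 ?g_gt0 ?subr_gt0.
    have [d d0 Hd] := near1 b h cmh hL Eh b0 _ e0.
    have [d' d'0 Hd'] := near1 b' h' cmh' h'L Eh' b'0 _ e0.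
    pose t := Num.min 1 (Num.min d d') / 2.
    have m0 : 0 < Num.min 1 (Num.min d d') by rewrite !lt_min ltr01 d0.
    have tm : t < Num.min 1 (Num.min d d') by rewrite /t; lra.
    have t0 : 0 < t by rewrite divr_gt0.
    move: tm; rewrite !lt_min => /and3P[t1' td td'].
    have /andP[_ h2] := Hd t t0 td; have /andP[h3 _] := Hd' t t0 td'.
    have gt : g 1 <= g t by rewrite cm_noninc // ltW.
    have : (b - b') * g 1 <= (b - b') * g t.
      by rewrite ler_wpM2l // subr_ge0 ltW.
    by lra.
  have aa' : a' = a.
    apply/eqP; rewrite eq_le; apply/andP; split.
      exact: (le_coef a' a f' f).
    exact: (le_coef a a' f f').
  split=> //; apply: integral_zext_cm => //; rewrite aa' in E'.
  exact: (regular_sonine_integral (ltW a0) (conj cmg gL) f'L (conj cmf fL) E' E).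
Qed.
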